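(* There are absolute constants $c,C>0$ such that the following holds. Let $\varepsilon\in(0,1)$ and let $G$ be an $n$-vertex graph which is $\varepsilon$-far from being chordal. Then there is an integer $\ell$ with $4\le \ell\le C\varepsilon^{-18}$ such that $G$ contains at least $n^{\ell}/2^{(1/\varepsilon)^c}$ induced copies of $C_\ell$.
   Context: A graph is chordal if it contains no induced cycle of length at least $4$. An $n$-vertex graph $G$ is $\varepsilon$-far from satisfying a property $\mathcal P$ if one must add and/or delete at least $\varepsilon n^2$ edges of $G$ in order to obtain a graph satisfying $\mathcal P$. An induced copy of $C_\ell$ in $G$ is a set of $\ell$ vertices of $G$ whose induced subgraph is a cycle of length $\ell$. *)

(* Defs.v *)
From mathcomp Require Import all_boot.
From Stdlib Require Import Reals.
Set Implicit Arguments. Unset Strict Implicit. Unset Printing Implicit Defensive.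

Definition simple_graph (V : finType) (g : rel V) : Prop :=
  (forall u v, g u v = g v u) /\ (forall u, g u u = false).

Definition cyc_adj (l : nat) (i j : 'I_l) : bool :=
  (val j == (val i).+1 %% l) || (val i == (val j).+1 %% l).

Definition induced_cycle (V : finType) (g : rel V) (l : nat) (S : {set V}) : bool :=
  [exists f : {ffun 'I_l -> V},
     [&& injectiveb f, (f @: setT) == S &
         [forall i, forall j, g (f i) (f j) == cyc_adj i j]]].

Definition num_induced_cycles (V : finType) (g : rel V) (l : nat) : nat :=
  #|[set S : {set V} | induced_cycle g l S]|.

Definition chordal (V : finType) (g : rel V) : Prop :=
  forall (l : nat) (S : {set V}), 4 <= l -> ~~ induced_cycle g l S.

Definition edit_dist (V : finType) (g h : rel V) : nat :=
  #|[set e : {set V} |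
      [exists u, exists v, [&& u != v, e == [set u; v] & g u v != h u v]]]|.

Definition eps_far_from_chordal (V : finType) (g : rel V) (eps : R) : Prop :=
  forall h : rel V, simple_graph h -> chordal h ->
    (eps * (INR #|V|) ^ 2 <= INR (edit_dist g h))%R.

(* Main.v *)
Require Import Defs.
From mathcomp Require Import all_boot zify.
Set Implicit Arguments. Unset Strict Implicit. Unset Printing Implicit Defensive.

(* Put [e = ceil (1 / eps)].  Suppose that every [C_l] with [4 <= l <= q = poly(e)] has few
   induced copies.  If, in some large [U], every vertex had many nonadjacent pairs of
   neighbours inside [U], then with positive probability no vertex of a random sample of [q]
   vertices of [U] would be simplicial in the sample; by Dirac's theorem the sample would
   contain a hole, of length at most [q], and hence holes of some fixed length would be
   plentiful.  So every large [U] has a nearly simplicial vertex, and eliminating these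
   greedily orders almost all vertices with few bad cherries: [a < b < c] with [ab], [ac]
   edges and [bc] a nonedge.

   It remains to make such an ordered graph chordal with few edits.  A random set [R] of
   polynomial size contains no bad cherry, so joining each vertex of [R] to its later
   neighbours defines a forest-like ancestor order on [R].  To a vertex [w] one attaches the
   subtree formed by the largest branch of its earlier neighbours in [R]; the intersection graph
   of these subtrees, together with simplicial vertices attached to it, is a chordal graph.
   To compare it with the graph one averages over the sets [R + v + w]: a sum over [(R, v, w)]
   is a sum over sets [P] of size [|R| + 2] and pairs [v, w] of [P], and inside a fixed [P]
   without bad cherries only a small proportion of the pairs can be wrong. *)

(** * Dirac's theorem *)

Section ShortestPath.
Variables (T : finType) (e : rel T).

Definition shortest (x : T) (p : seq T) :=
  forall p', path e x p' -> last x p' = last x p -> size p <= size p'.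

Lemma shortest_pathP x y :
  connect e x y -> exists p, [/\ path e x p, last x p = y & shortest x p].
Proof.
move=> /connectP[p0 p0P ly].
pose P n := [exists t : n.-tuple T, path e x t && (last x t == y)].
have exP : exists n, P n.
  by exists (size p0); apply/existsP; exists (in_tuple p0); rewrite p0P ly eqxx.
case: (ex_minnP exP) => n /existsP[t /andP[tP /eqP lt]] nmin.
exists t; split=> // p' p'P lp'; rewrite size_tuple; apply: nmin.
by apply/existsP; exists (in_tuple p'); rewrite p'P lp' lt eqxx.
Qed.

Variables (x : T) (p : seq T).
Hypotheses (pP : path e x p) (pmin : shortest x p).

Lemma last_take i : i <= size p -> last x (take i p) = nth x (x :: p) i.
Proof. by move=> ip; rewrite -nth_last /= size_takel //; case: i ip => [|i] ip; rewrite ?take0 //= nth_take. Qed.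

(** A chord is a shortcut: following it gives a path with the same ends that is strictly shorter
    unless it joins consecutive vertices. *)
Lemma shortest_chord i j : i < j <= size p ->
  e (nth x (x :: p) i) (nth x (x :: p) j) -> j = i.+1.
Proof.
case: j => [|j] // /andP[ij jp] /= eij.
have dE : drop j p = nth x p j :: drop j.+1 p by rewrite (drop_nth x).
have lastt : last x (take i p) = nth x (x :: p) i by rewrite last_take //; lia.
have := pmin (p' := take i p ++ drop j p).
rewrite cat_path lastt dE /= eij take_path // size_cat /= size_drop size_takel; last by lia.
move=> /= H.
have {}H : size p <= i + (size p - j.+1).+1.
  apply: H; last by rewrite last_cat /= -[in RHS](cat_take_drop j p) last_cat dE.
  have : path e x (take j p ++ drop j p) by rewrite cat_take_drop.
  by rewrite cat_path dE /= => /and3P[].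
lia.
Qed.

Lemma shortest_inj i j : i < j <= size p ->
  nth x (x :: p) i != nth x (x :: p) j.
Proof.
move=> /andP[ij jp]; apply/eqP => eij.
have := pmin (p' := take i p ++ drop j p).
have lastt : last x (take i p) = nth x (x :: p) i by rewrite last_take //; lia.
have lastj : last x (take j p) = nth x (x :: p) j by rewrite last_take.
rewrite cat_path lastt take_path // size_cat /= size_drop size_takel; last by lia.
move=> H.
have {}H : size p <= i + (size p - j).
  apply: H.
    have : path e x (take j p ++ drop j p) by rewrite cat_take_drop.
    by rewrite cat_path lastj -eij => /andP[].
  by rewrite last_cat lastt eij -lastj -last_cat cat_take_drop.
lia.
Qed.
End ShortestPath.

Section Dirac.
Variables (V : finType) (g : rel V).
Hypotheses (gsym : forall u v, g u v = g v u) (girr : forall u, g u u = false).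

Definition simplicial_in (Q : {set V}) (v : V) : bool :=
  [forall a in Q, forall b in Q, [&& g v a, g v b & a != b] ==> g a b].

Lemma simplicial_inP (Q : {set V}) v :
  reflect (forall a b, a \in Q -> b \in Q -> g v a -> g v b -> a != b -> g a b)
          (simplicial_in Q v).
Proof.
apply: (iffP forall_inP) => [H a b aQ bQ va vb ab|H a aQ].
  by move/forall_inP: (H a aQ) => /(_ b bQ); rewrite va vb ab.
by apply/forall_inP => b bQ; apply/implyP => /and3P[]; apply: H.
Qed.

(** Removes the modulus, so that adjacency in a cycle becomes linear arithmetic on indices. *)
Lemma cyc_adj_succ l (i j : 'I_l) : 2 < l ->
  cyc_adj i j = [|| val j == (val i).+1, val i == (val j).+1,
     (val i == 0) && (val j == l.-1) | (val j == 0) && (val i == l.-1)].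
Proof.
move=> l2; rewrite /cyc_adj.
have mE (a : 'I_l) : (val a).+1 %% l = if val a == l.-1 then 0 else (val a).+1.
  have /= al := ltn_ord a.
  case: eqP => al1; first by rewrite [X in X %% _](_ : _ = l) ?modnn //=; lia.
  by rewrite modn_small //=; lia.
rewrite !mE; have /= := ltn_ord i; have /= := ltn_ord j.
case: (val i == l.-1) / eqP; case: (val j == l.-1) / eqP => /=; lia.
Qed.

(** A shortest path has no chord and [v] sees only its two ends, so [v] closes it up to an induced
    cycle on [(size p).+2] vertices. The ends are distinct and nonadjacent, hence [size p] is at
    least 2. *)
Lemma induced_cycle_through_path v x (C : {set V}) p :
    let e := [rel a b | [&& g a b, a \in C & b \in C]] in
    path e x p -> shortest e x p -> x \in C ->
    ~~ g x (last x p) -> x != last x p ->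
    g v x -> g v (last x p) -> v \notin C ->
    (forall c, c \in C -> g v c -> c = x \/ c = last x p) ->
  exists l (S : {set V}), [/\ 4 <= l, induced_cycle g l S & S \subset v |: C].
Proof.
move=> e pP pmin xC nxy xy vx vy vC vN.
have sp2 : 1 < size p.
  case: p pP nxy xy {pmin vy vN} => [|a [|b q]] //=; first by rewrite eqxx.
  by rewrite andbT => /and3P[->].
have sC i : i <= size p -> nth x (x :: p) i \in C.
  case: i => [|i] //= ip.
  have := pathP x pP _ ip; by rewrite /= => /and3P[].
have snext i : i < size p -> g (nth x (x :: p) i) (nth x (x :: p) i.+1).
  by move=> ip; have := pathP x pP _ ip => /and3P[].
have lastE : last x p = nth x (x :: p) (size p) by rewrite -last_take // take_size.
have sinj i j : i <= size p -> j <= size p ->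
    nth x (x :: p) i = nth x (x :: p) j -> i = j.
  move=> ip jp eij; case: (ltngtP i j) => // h.
    by have := @shortest_inj _ e x p pP pmin i j; rewrite eij eqxx h jp => /(_ isT).
  by have := @shortest_inj _ e x p pP pmin j i; rewrite eij eqxx h ip => /(_ isT).
have sadj i j : i < j <= size p -> g (nth x (x :: p) i) (nth x (x :: p) j) = (j == i.+1).
  move=> /andP[ij jp]; apply/idP/eqP => [gij|->]; last by apply: snext; lia.
  apply: (@shortest_chord _ e x p pP pmin); rewrite ?ij ?jp //.
  by rewrite /e /= gij !(sC i, sC j) //; lia.
have svadj i : i <= size p -> g v (nth x (x :: p) i) = (i == 0) || (i == size p).
  move=> ip; apply/idP/orP => [gi|[/eqP->|/eqP->]] //; last by rewrite -lastE.
  case: (vN _ (sC _ ip) gi) => h; [left|right]; apply/eqP; apply: sinj => //.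
  by rewrite h lastE.
clear nxy xy vx vy vN; set l := (size p).+2.
pose f : {ffun 'I_l -> V} := [ffun i : 'I_l => nth x (v :: x :: p) i].
exists l, (f @: setT); split; first by rewrite /l; lia.
- apply/existsP; exists f; rewrite eqxx /=; apply/andP; split.
    apply/injectiveP => i j; rewrite !ffunE => eij; apply: val_inj.
    move: eij; case: i j => [[|i] il] [[|j] jl] //=.
    - by move=> h; rewrite h sC in vC.
    - by move=> h; rewrite -h sC in vC.
    - by move/sinj => -> //.
  apply/forallP => i; apply/forallP => j; rewrite cyc_adj_succ; last by rewrite /l; lia.
  rewrite !ffunE; case: i j => [[|i] il] [[|j] jl] /=.
  - by rewrite girr /l; lia.
  - by rewrite svadj /l; lia.
  - by rewrite gsym svadj /l; lia.
  - case: (ltngtP i j) => ij.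
    + by rewrite sadj; last lia; apply/eqP; rewrite /l; lia.
    + by rewrite gsym sadj; last lia; apply/eqP; rewrite /l; lia.
    + by rewrite ij girr /l; lia.
- apply/subsetP => z /imsetP[i _ ->]; rewrite ffunE !inE.
  by case: i => [[|i] il] /=; rewrite ?eqxx // sC ?orbT.
Qed.

Definition hole_free_in (Q : {set V}) : Prop :=
  forall l (S : {set V}), 4 <= l -> induced_cycle g l S -> ~~ (S \subset Q).

Lemma hole_free_sub (P Q : {set V}) : P \subset Q -> hole_free_in Q -> hole_free_in P.
Proof. by move=> PQ HQ l S l4 /(HQ l S l4); apply: contra => /subset_trans; apply. Qed.

(* [C] is a connected component of [Q] minus the closed neighbourhood of [v]; its
   neighbours [S] form a clique, for otherwise a shortest path through [C] between two
   nonadjacent ones closes up through [v] to a hole. *)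
Lemma simplicial_nonneighbor (Q : {set V}) v u :
  hole_free_in Q -> v \in Q -> u \in Q -> u != v -> ~~ g v u ->
  exists w, [/\ w \in Q, w != v, ~~ g v w & simplicial_in Q w].
Proof.
have [n] := ubnP #|Q|; elim: n Q v u => // n IHn Q v u leQ HQ vQ uQ uv nvu.
pose Z := [set z in Q | (z != v) && ~~ g v z].
pose ez := [rel a b | [&& g a b, a \in Z & b \in Z]].
pose C := [set c | connect ez u c].
pose S := [set s in Q | g v s && [exists c in C, g c s]].
have ezsym : connect_sym ez.
  by apply: sym_connect_sym => a b; rewrite /ez /= gsym; do 2 case: (_ \in Z).
have uZ : u \in Z by rewrite inE uQ uv.
have uC : u \in C by rewrite inE connect0.
have CZ c : c \in C -> c \in Z.
  rewrite inE => /connectP[p]; case/lastP: p => [|p z]; first by move=> _ ->.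
  by rewrite rcons_path last_rcons => /andP[_ /and3P[_ _ zZ]] ->.
have CQ c : c \in C -> c \in Q by move/CZ; rewrite inE => /and3P[].
have Cv c : c \in C -> c != v by move/CZ; rewrite inE => /and3P[].
have Cnv c : c \in C -> ~~ g v c by move/CZ; rewrite inE => /and3P[].
have closedC c a : c \in C -> a \in Q -> g c a -> a \in C :|: S.
  move=> cC aQ ca; rewrite !inE aQ /=; case: (boolP (g v a)) => va /=.
    by apply/orP; right; apply/existsP; exists c; rewrite cC ca.
  rewrite orbF; have := cC; rewrite inE => uc; apply: (connect_trans uc).
  apply: connect1; rewrite /ez /= ca CZ //= inE aQ va andbT.
  by apply: contraTneq ca => ->; rewrite gsym Cnv.
have cliqueS x y : x \in S -> y \in S -> x != y -> g x y.
  move=> xS yS xy; apply/negPn/negP => nxy.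
  pose C' := x |: (y |: C).
  pose e := [rel a b | [&& g a b, a \in C' & b \in C']].
  have esym : connect_sym e.
    by apply: sym_connect_sym => a b; rewrite /e /= gsym; do 2 case: (_ \in C').
  have CC' c : c \in C -> c \in C' by rewrite !(inE, in_setU) => ->; rewrite !orbT.
  have conC c : c \in C -> connect e u c.
    rewrite inE => /connectP[p]; elim/last_ind: p c => [|p z IHp] c; first by move=> _ ->; apply: connect0.
    rewrite rcons_path last_rcons => /andP[pP ez_z] ->.
    have lC : last u p \in C by rewrite inE; apply/connectP; exists p.
    have zC : z \in C.
      by move: lC; rewrite !inE => ulp; apply: (connect_trans ulp); apply: connect1.
    apply: (connect_trans (IHp _ pP erefl)); apply: connect1.
    by case/and3P: ez_z => gz _ _; rewrite /e /= gz !CC'.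
  have xC' : x \in C' by rewrite !inE eqxx.
  have yC' : y \in C' by rewrite !inE eqxx orbT.
  have vS s : s \in S -> g v s by rewrite inE => /and3P[].
  have toC s : s \in S -> s \in C' -> connect e u s.
    rewrite inE => /and3P[_ _ /existsP[c /andP[cC gcs]]] sC'.
    by apply: (connect_trans (conC c cC)); apply: connect1; rewrite /e /= gcs CC'.
  have : connect e x y by rewrite (connect_trans _ (toC _ yS yC')) // esym toC.
  case/shortest_pathP => p [pP lp pmin].
  have vC : v \notin C by apply/negP => /Cv; rewrite eqxx.
  have vC' : v \notin C'.
    rewrite !in_setU !in_set1 !negb_or; apply/and3P; split.
    - by apply: contraTneq (vS _ xS) => <-; rewrite girr.
    - by apply: contraTneq (vS _ yS) => <-; rewrite girr.
    - exact: vC.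
  have [l [S' [l4 cS' S'C]]] : exists l (S' : {set V}),
      [/\ 4 <= l, induced_cycle g l S' & S' \subset v |: C'].
    apply: (@induced_cycle_through_path v x C' p pP pmin) => //; rewrite ?lp //;
      rewrite ?vS //.
    move=> c; rewrite !in_setU !in_set1 => /or3P[/eqP->|/eqP->|cC] vc; [by left|by right|].
    by move: (Cnv c cC); rewrite vc.
  have /negP[] := HQ _ _ l4 cS'; apply: (subset_trans S'C).
  apply/subsetP => z; rewrite !in_setU !in_set1 => /or4P[/eqP->|/eqP->|/eqP->|] //; last exact: CQ.
    by move: xS; rewrite inE => /andP[].
  by move: yS; rewrite inE => /andP[].
pose Q' := C :|: S.
have Q'Q : Q' \subset Q.
  by apply/subsetP => z; rewrite in_setU => /orP[/CQ //|]; rewrite inE => /andP[].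
have vQ' : v \notin Q'.
  rewrite in_setU negb_or; apply/andP; split; first by apply/negP => /Cv; rewrite eqxx.
  by rewrite inE girr andbF.
have ltQ' : #|Q'| < n.
  rewrite ltnS in leQ; apply: leq_trans leQ; apply: proper_card; apply/properP; split=> //; by exists v.
(* By [closedC], all neighbours in [Q] of a vertex of [C] lie in [Q'], so it suffices to be
   simplicial in this smaller set. *)
suff [w wC wsimp] : exists2 w, w \in C & simplicial_in Q' w.
  exists w; split; [exact: CQ|exact: Cv|exact: Cnv|].
  apply/simplicial_inP => a b aQ bQ wa wb; move/simplicial_inP: wsimp; apply => //; exact: closedC wC _ _.
have IH v' u' : v' \in Q' -> u' \in Q' -> u' != v' -> ~~ g v' u' ->
    exists w, [/\ w \in Q', w != v', ~~ g v' w & simplicial_in Q' w].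
  by apply: (IHn Q' v' u' ltQ'); apply: hole_free_sub HQ.
(* First case: some [v'] in [S] has a nonneighbour in [Q']. Induction gives a simplicial vertex not
   adjacent to [v']; it avoids the clique [S], hence lies in [C]. *)
have [/existsP[v' /existsP[u' /and5P[v'S v'Q u'Q uv' nvu']]]|noS] :=
    boolP [exists v', exists u', [&& v' \in S, v' \in Q', u' \in Q', u' != v' & ~~ g v' u']].
  have [w [wQ wv' nvw ws]] := IH v' u' v'Q u'Q uv' nvu'; exists w => //.
  move: wQ; rewrite in_setU => /orP[//|wS]; case/negP: nvw; apply: cliqueS => //.
  by rewrite eq_sym.
have adjS a b : a \in S -> b \in Q' -> b != a -> g a b.
  move=> aS bQ ba; apply/negPn/negP => nab; case/negP: noS; apply/existsP; exists a.
  by apply/existsP; exists b; rewrite aS ba bQ nab /Q' in_setU aS orbT.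
(* Second case: [S] is joined to all of [Q'], so a vertex with a nonneighbour in [Q'] must lie in
   [C]. In the last case [Q'] is a clique and [u] itself serves. *)
have [/existsP[v' /existsP[u' /and4P[v'Q u'Q uv' nvu']]]|noC] :=
    boolP [exists v', exists u', [&& v' \in Q', u' \in Q', u' != v' & ~~ g v' u']].
  have [w [wQ wv' nvw ws]] := IH v' u' v'Q u'Q uv' nvu'; exists w => //.
  move: (wQ); rewrite in_setU => /orP[//|wS]; case/negP: nvw.
  by rewrite gsym adjS // eq_sym.
exists u => //; apply/simplicial_inP => a b aQ bQ _ _ ab; apply/negPn/negP => nab.
case/negP: noC; apply/existsP; exists a; apply/existsP; exists b.
by rewrite aQ bQ nab eq_sym ab.
Qed.

Lemma simplicial_vertex (Q : {set V}) :
  hole_free_in Q -> Q != set0 -> exists2 v, v \in Q & simplicial_in Q v.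
Proof.
move=> HQ /set0Pn[v vQ].
have [/simplicial_inP vs|] := boolP (simplicial_in Q v); first by exists v => //; apply/simplicial_inP.
case/forall_inPn => a aQ /forall_inPn[b bQ]; rewrite negb_imply => /andP[/and3P[_ _ ab] nab].
rewrite eq_sym in ab.
by have [w [wQ _ _ ws]] := simplicial_nonneighbor HQ aQ bQ ab nab; exists w.
Qed.

(** In a hole the two cyclic neighbours of any vertex are distinct and nonadjacent, so the vertex
    set of a hole has no simplicial vertex. *)
Lemma chordal_of_simplicial :
  (forall Q : {set V}, Q != set0 -> exists2 v, v \in Q & simplicial_in Q v) -> chordal g.
Proof.
move=> Hs l S l4; apply/negP => /existsP[f /and3P[/injectiveP finj _ /forallP fadj]].
have l0 : 0 < l by lia.
have fg i j : g (f i) (f j) = cyc_adj i j by apply/eqP; move/forallP: (fadj i).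
have [|v /imsetP[[a al] _ ->] /simplicial_inP H] := Hs (f @: setT).
  by apply/set0Pn; exists (f (Ordinal l0)); apply: imset_f.
have sl : (if a == l.-1 then 0 else a.+1) < l by case: eqP => /= ?; lia.
have pl : (if a == 0 then l.-1 else a.-1) < l by case: eqP => /= ?; lia.
have := H (f (Ordinal sl)) (f (Ordinal pl)); rewrite !imset_f // !fg (inj_eq finj).
rewrite !cyc_adj_succ ?(leq_trans _ l4) // -(inj_eq val_inj) /= => /(_ isT isT) {H}.
by case: (a == l.-1) / eqP; case: (a == 0) / eqP => /= a0 al1 H;
  suff: false by []; move: H; lia.
Qed.
End Dirac.

(** * Random samples and greedy elimination *)

Lemma card_bigcup_leq (I T : finType) (P : pred I) (A : I -> {set T}) :
  #|\bigcup_(i | P i) A i| <= \sum_(i | P i) #|A i|.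
Proof.
elim/big_rec2: _ => [|i n S _ IH]; first by rewrite cards0.
by apply: leq_trans (leq_card_setU _ _) _; rewrite leq_add2l.
Qed.

Lemma card_family_prod (I T : finType) (G : I -> {set T}) :
  #|family (fun j => mem (G j))| = \prod_j #|G j|.
Proof. by rewrite card_family foldrE big_map big_enum. Qed.

Section Cover.
Variables (I V : finType) (U : {set V}) (l : nat) (c : {ffun 'I_l -> V}).
Hypothesis cinj : injective c.

(** The [l] coordinates in the image of [iota] are forced, the others range over [U]: the maps lie
    in a product of sets [G j]. *)
Lemma card_extend (iota : {ffun 'I_l -> I}) : injective iota ->
  #|[set f : {ffun I -> V} | (f \in ffun_on U) && [forall a, f (iota a) == c a]]|
    <= #|U| ^ (#|I| - l).
Proof.
move=> iinj.
pose J := [set iota a | a in 'I_l].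
have cJ : #|J| = l by rewrite card_imset // card_ord.
pose G j : {set V} := if [pick a | iota a == j] is Some a then [set c a] else U.
have -> : #|U| ^ (#|I| - l) = \prod_(j : I) #|G j|.
  rewrite (bigID (mem J)) /= big1 ?mul1n => [|j /imsetP[a _ ->]].
    rewrite (eq_bigr (fun=> #|U|)) => [|j jJ].
      by rewrite prod_nat_const -cJ; congr (_ ^ _); rewrite -(cardC (mem J)) addKn; apply: eq_card.
    rewrite /G; case: pickP => // a /eqP ej; case/negP: jJ; apply/imsetP; by exists a.
  rewrite /G; case: pickP => [b|/(_ a)]; rewrite ?eqxx //; by rewrite cards1.
rewrite -card_family_prod; apply: subset_leq_card.
apply/subsetP => f; rewrite inE => /andP[/ffun_onP fU /forallP fc]; apply/familyP => j.
rewrite /G; case: pickP => [a /eqP <-|_]; last exact: fU.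
by rewrite inE (eqP (fc a)).
Qed.

(** Union bound over the choice [iota] of positions at which the points of [c] are hit; a
    non-injective choice contributes nothing, since [c] is injective. *)
Lemma card_cover :
  #|[set f : {ffun I -> V} | (f \in ffun_on U) && (c @: setT \subset f @: setT)]|
    <= #|I| ^ l * #|U| ^ (#|I| - l).
Proof.
pose A (iota : {ffun 'I_l -> I}) :=
  [set f : {ffun I -> V} | (f \in ffun_on U) && [forall a, f (iota a) == c a]].
apply: leq_trans (_ : #|\bigcup_iota A iota| <= _).
  apply: subset_leq_card; apply/subsetP => f; rewrite inE => /andP[fU /subsetP cf].
  have fpre a : exists i, f i == c a.
    by have /imsetP[i _ ->] := cf _ (imset_f c (in_setT a)); exists i.
  apply/bigcupP; exists [ffun a => xchoose (fpre a)] => //.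
  by rewrite inE fU; apply/forallP => a; rewrite ffunE (xchooseP (fpre a)).
apply: leq_trans (card_bigcup_leq _ _) _.
apply: leq_trans (_ : \sum_(iota : {ffun 'I_l -> I}) #|U| ^ (#|I| - l) <= _); last first.
  by rewrite sum_nat_const card_ffun card_ord.
apply: leq_sum => iota _; have [/injectiveP|ninj] := boolP (injectiveb iota).
  exact: card_extend.
rewrite (_ : A iota = set0) ?cards0 //; apply/setP => f; rewrite !inE.
apply: contraNF ninj => /andP[_ /forallP fc]; apply/injectiveP => a b ab; apply: cinj.
by rewrite -(eqP (fc a)) ab (eqP (fc b)).
Qed.
End Cover.

(** Bernoulli's inequality for 1 + 1/p, with denominators cleared. *)
Lemma leq_mul_expS p j : p ^ j * (p + j) <= p * p.+1 ^ j.
Proof.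
elim: j => [|j IH]; first by rewrite !expn0; lia.
rewrite [p.+1 ^ _]expnSr mulnA; apply: leq_trans (leq_mul IH (leqnn _)).
by rewrite expnSr -!mulnA leq_mul2l; apply/orP; right; nia.
Qed.

(** That is, (1 - 1/d)^d is at most 1/2, by Bernoulli applied to 1 + 1/(d-1); [d = 1] is
    separate. *)
Lemma leq_double_exp d m n : 0 < d -> d * m <= d.-1 * n -> 2 * m ^ d <= n ^ d.
Proof.
case: d => // p _ /= H.
case: p => [|p] in H *; first by rewrite mul0n leqn0 muln_eq0 /= in H; rewrite (eqP H) exp0n.
have pp : 2 * p.+1 ^ p.+2 <= p.+2 ^ p.+2.
  rewrite -(leq_pmul2l (ltn0Sn p)); apply: leq_trans (leq_mul_expS _ _).
  by rewrite mulnA mulnC leq_mul2l; apply/orP; right; lia.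
have := H; rewrite -(leq_exp2r _ _ (e := p.+2)) // !expnMn => {}H.
rewrite -(leq_pmul2l (_ : 0 < p.+2 ^ p.+2)) ?expn_gt0 // mulnCA.
apply: leq_trans (_ : 2 * (p.+1 ^ p.+2 * n ^ p.+2) <= _); first by rewrite leq_mul2l H.
by rewrite mulnA leq_mul2r pp orbT.
Qed.

Section Sampling.
Variables (V : finType) (g : rel V).
Hypotheses (gsym : forall u v, g u v = g v u) (girr : forall u, g u u = false).

(** Each such pair witnesses that [v] is not simplicial in [U]. The pairs are ordered, hence
    measured against [#|U| ^ 2]. *)
Definition open_pairs (U : {set V}) (v : V) : {set V * V} :=
  [set p in setX U U | [&& g v p.1, g v p.2, p.1 != p.2 & ~~ g p.1 p.2]].

Variables (U : {set V}) (d t k : nat).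
Hypotheses (d0 : 0 < d) (kE : k = (d * t).+1) (kt : 4 * k <= 2 ^ t).
Hypothesis many_open : forall v, v \in U -> #|U| ^ 2 <= d * #|open_pairs U v|.

Let side (b : bool) (x : V * V) : V := if b then x.2 else x.1.
Let avoid v := setX U U :\: open_pairs U v.

(** The sample consists of [k] independent pairs, that is [2 * k] vertices; it fails if one of these
    vertices has no open pair among the sampled ones. *)
Let missing (p : {ffun 'I_k -> V * V}) : bool :=
  [exists i, exists b, [forall j, p j \notin open_pairs U (side b (p i))]].

(** A random pair is open for [v] with probability at least 1/d. The [d * t] pairs other than the
    one containing the tested vertex form [t] groups of [d], and each group gains a factor 1/2. *)
Lemma card_avoid v : v \in U -> #|avoid v| ^ k.-1 * 2 ^ t <= (#|U| ^ 2) ^ k.-1.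
Proof.
move=> vU; have t0 : 0 < t by case: t kt => //; rewrite kE; lia.
rewrite kE /= !expnM -expnMn leq_exp2r // mulnC; apply: leq_double_exp => //.
have sub : open_pairs U v \subset setX U U by apply/subsetP => p; rewrite inE => /andP[].
have cU : #|setX U U| = #|U| ^ 2 by rewrite cardsX mulnn.
have := cardsD (setX U U) (open_pairs U v); rewrite (setIidPr sub) -/(avoid v) cU => ->.
have := many_open vU; have := subset_leq_card sub; rewrite cU.
by case: d d0 => // d' _ /= _; rewrite mulnBr [d'.+1 * _ ^ _]mulSn leq_subLR leq_add2r.
Qed.

Lemma card_missing :
  2 * #|[set p | (p \in ffun_on (setX U U)) && missing p]| <= (#|U| ^ 2) ^ k.
Proof.
(* Pinning the pair at [i] to [x] fixes the tested vertex, so that the failures form a product set.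
   The union bound over the [2 * k] vertices then loses [2 * k], which [2 ^ t] absorbs. *)
pose F (i : 'I_k) (x : V * V) (b : bool) (j : 'I_k) : {set V * V} := if j == i then [set x] else avoid (side b x).
pose A (z : 'I_k * (V * V) * bool) := [set p | p \in family (fun j => mem (F z.1.1 z.1.2 z.2 j))].
pose P := [pred z : 'I_k * (V * V) * bool | z.1.2 \in setX U U].
have cA z : P z -> #|A z| * 2 ^ t <= (#|U| ^ 2) ^ k.-1.
  case: z => [[i x] b] /= xU.
  have -> : #|A (i, x, b)| = #|avoid (side b x)| ^ k.-1.
    rewrite cardsE card_family_prod (bigD1 i) //= {1}/F eqxx cards1 mul1n.
    rewrite (eq_bigr (fun=> #|avoid (side b x)|)) => [|j ji]; last by rewrite /F (negPf ji).
    by rewrite prod_nat_const cardC1 card_ord.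
  by apply: card_avoid; move: xU; rewrite inE => /andP[]; case: b.
have sub : [set p | (p \in ffun_on (setX U U)) && missing p] \subset \bigcup_(z | P z) A z.
  apply/subsetP => p; rewrite inE => /andP[/ffun_onP pU /existsP[i /existsP[b /forallP H]]].
  apply/bigcupP; exists (i, p i, b); rewrite /= ?pU // inE; apply/familyP => j /=.
  by rewrite /F; case: eqP => [->|_]; rewrite inE ?H ?pU.
have cP : #|P| = k * #|U| ^ 2 * 2.
  have -> : #|P| = #|setX (setX [set: 'I_k] (setX U U)) [set: bool]|.
    by apply: eq_card => -[[i x] b]; rewrite !inE andbT.
  by rewrite !cardsX !cardsT card_ord card_bool mulnn.
have k0 : 0 < k by rewrite kE.
have : #|\bigcup_(z | P z) A z| * 2 ^ t <= 2 * k * (#|U| ^ 2) ^ k.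
  apply: leq_trans (_ : (\sum_(z | P z) #|A z|) * 2 ^ t <= _); first by rewrite leq_mul2r card_bigcup_leq orbT.
  rewrite big_distrl /=; apply: leq_trans (_ : \sum_(z | P z) (#|U| ^ 2) ^ k.-1 <= _).
    exact: leq_sum.
  rewrite sum_nat_const cP -[in X in _ <= X](prednK k0) [_ ^ k.-1.+1]expnS (prednK k0); lia.
move=> H; have {}H := leq_trans (leq_mul (subset_leq_card sub) kt) H.
by rewrite -(leq_pmul2l (_ : 0 < 2 * k)) ?muln_gt0 //; apply: leq_trans H; lia.
Qed.

Let holes_of_size (l : nat) := [set S : {set V} | induced_cycle g l S].

Lemma induced_cycle_size l S : induced_cycle g l S ->
  exists2 c : {ffun 'I_l -> V}, injective c & S = c @: setT.
Proof. by case/existsP => c /and3P[/injectiveP cinj /eqP cS _]; exists c. Qed.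

(** When nothing is missing, no vertex is simplicial in the sample, so by Dirac's theorem the sample
    contains a hole; its length is at most the sample size. *)
Lemma sample_has_hole (f : {ffun 'I_k * bool -> V}) :
    f \in ffun_on U -> ~~ missing [ffun j => (f (j, false), f (j, true))] ->
  f \in \bigcup_(l < (2 * k).+1 | 4 <= l) \bigcup_(S in holes_of_size l)
     [set f : {ffun 'I_k * bool -> V} | (f \in ffun_on U) && (S \subset f @: setT)].
Proof.
move=> fU nmiss; apply/negPn/negP => nf.
have cQ : #|f @: setT| <= 2 * k.
  by apply: leq_trans (leq_imset_card _ _) _; rewrite cardsT card_prod card_ord card_bool mulnC.
have Q0 : f @: setT != set0.
  have k0 : 0 < k by rewrite kE.
  by apply/set0Pn; exists (f (Ordinal k0, false)); apply: imset_f.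
have hf : hole_free_in g (f @: setT).
  move=> l S l4 cS; apply: contra nf => SQ.
  have lk : l < (2 * k).+1.
    have [c cinj Sc] := induced_cycle_size cS; rewrite ltnS; apply: leq_trans cQ.
    by apply: leq_trans (subset_leq_card SQ); rewrite Sc card_imset // cardsT card_ord.
  apply/bigcupP; exists (Ordinal lk) => //; apply/bigcupP; exists S; first by rewrite inE.
  by rewrite inE fU.
have [v /imsetP[[i b] _ vE] /simplicial_inP vs] := simplicial_vertex gsym girr hf Q0.
case/negP: nmiss; apply/existsP; exists i; apply/existsP; exists b; apply/forallP => j.
rewrite !ffunE (_ : side _ _ = v); last by rewrite vE; case: b {vE}.
apply/negP; rewrite inE => /andP[_ /and4P[/= ga gb nab /negP[]]].
by apply: vs; rewrite ?imset_f.
Qed.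

(** At least half of the samples contain a hole, while a fixed hole of length [l] is covered by at
    most [q ^ l * u ^ (q - l)] of the [u ^ q] samples. Pigeonhole over the lengths costs the factor
    [q.+1]. *)
Lemma many_holes_of_open_pairs : 0 < #|U| ->
  exists l, [/\ 4 <= l, l <= 2 * k &
    #|U| ^ l <= 2 * (2 * k).+1 * (2 * k) ^ (2 * k) * num_induced_cycles g l].
Proof.
move=> U0; set q := 2 * k; set u := #|U|.
have k0 : 0 < k by rewrite kE.
have [/existsP[l /andP[l4 lH]]|/existsPn noL] := boolP [exists l : 'I_q.+1, (4 <= l) &&
    (u ^ l <= 2 * q.+1 * q ^ q * num_induced_cycles g l)].
  by exists l; split => //; rewrite -ltnS.
exfalso.
pose phi (f : {ffun 'I_k * bool -> V}) := [ffun j => (f (j, false), f (j, true))].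
have phi_inj : injective phi.
  move=> f1 f2 /ffunP E; apply/ffunP => -[j b]; have := E j; rewrite !ffunE => -[].
  by case: b.
pose all_f := [set f : {ffun 'I_k * bool -> V} | f \in ffun_on U].
pose bad := [set f in all_f | missing (phi f)].
have c_all : #|all_f| = u ^ q by rewrite cardsE card_ffun_on card_prod card_ord card_bool mulnC.
have c_bad : 2 * #|bad| <= u ^ q.
  rewrite /q expnM; apply: leq_trans card_missing; rewrite leq_pmul2l // -(card_imset _ phi_inj).
  apply: subset_leq_card; apply/subsetP => _ /imsetP[f + ->]; rewrite !inE => /andP[/ffun_onP fU ->].
  by rewrite andbT; apply/ffun_onP => j; rewrite ffunE inE !fU.
have c_good : #|all_f :\: bad| <= \sum_(l < q.+1 | 4 <= l) num_induced_cycles g l * (q ^ l * u ^ (q - l)).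
  apply: leq_trans (_ : #|\bigcup_(l < (2 * k).+1 | 4 <= l) \bigcup_(S in holes_of_size l)
     [set f : {ffun 'I_k * bool -> V} | (f \in ffun_on U) && (S \subset f @: setT)]| <= _).
    apply: subset_leq_card; apply/subsetP => f; rewrite !inE => /andP[+ fU].
    by rewrite fU /= => /(sample_has_hole fU).
  apply: leq_trans (card_bigcup_leq _ _) _; apply: leq_sum => l _.
  apply: leq_trans (card_bigcup_leq _ _) _.
  rewrite /num_induced_cycles -sum_nat_const; apply: leq_sum => S; rewrite inE => cS.
  have [c cinj ->] := induced_cycle_size cS.
  by have := card_cover ('I_k * bool)%type U cinj; rewrite card_prod card_ord card_bool [k * 2]mulnC.
have : 2 * q.+1 * #|all_f :\: bad| < q.+1 * u ^ q.
  (* The predecessor records the strict bound on each term; the total stays strict even if no length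
     qualifies. *)
  apply: leq_ltn_trans (_ : \sum_(l < q.+1 | 4 <= l) (u ^ q).-1 < _).
    apply: leq_trans (leq_mul (leqnn _) c_good) _; rewrite big_distrr /=; apply: leq_sum => l l4.
    have uq : u ^ q = u ^ l * u ^ (q - l) by rewrite -expnD subnKC // -ltnS.
    have := noL l; rewrite l4 /= -ltnNge => H.
    have ql : q ^ l <= q ^ q by rewrite leq_pexp2l ?muln_gt0 // -ltnS.
    suff : 2 * q.+1 * (num_induced_cycles g l * (q ^ l * u ^ (q - l))) < u ^ q by lia.
    rewrite uq !mulnA ltn_pmul2r ?expn_gt0 ?U0 //; apply: leq_ltn_trans H.
    by rewrite -[X in _ <= X]mulnA [_ ^ q * _]mulnC mulnA leq_mul2l ql orbT.
  rewrite sum_nat_const; apply: leq_ltn_trans (_ : q.+1 * (u ^ q).-1 < _).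
    by rewrite leq_mul2r; apply/orP; right; rewrite -[X in _ <= X](card_ord q.+1) max_card.
  by rewrite ltn_pmul2l // ltn_predL expn_gt0 U0.
have := cardsID bad all_f; rewrite (setIidPr _) ?c_all; last by apply/subsetP => f; rewrite inE => /andP[].
nia.
Qed.

End Sampling.

Section GreedyOrdering.
Variables (V : finType) (g : rel V) (n d e1 : nat).
Hypothesis nearly_simplicial : forall U : {set V}, n <= e1 * #|U| ->
  exists2 v, v \in U & d * #|open_pairs g U v| <= n ^ 2.

(** Remove a nearly simplicial vertex, give it rank 0 and shift the ranks of the rest. Once too few
    vertices remain, they form [U0] and are ranked arbitrarily. *)
Lemma greedy_ordering (U : {set V}) : exists (rk : V -> nat) (U0 : {set V}),
  [/\ {in U &, injective rk}, e1 * #|U0| < n &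
   forall v, v \in U -> v \notin U0 ->
    d * #|[set p in open_pairs g U v | (rk v < rk p.1) && (rk v < rk p.2)]| <= n ^ 2].
Proof.
have [m] := ubnP #|U|; elim: m U => // m IHm U leU.
case: (ltnP (e1 * #|U|) n) => [Un|nU].
  exists (fun v : V => nat_of_ord (enum_rank v)), U; split=> //; last by move=> v ->.
  by move=> u v _ _ /val_inj /enum_rank_inj.
have [v vU vd] := nearly_simplicial nU.
have [|rk [U0 [rkinj U0n H]]] := IHm (U :\ v); first by rewrite (cardsD1 v U) vU in leU.
exists (fun w => if w == v then 0 else (rk w).+1), U0; split=> //.
  move=> a b aU bU; case: eqP => [->|/eqP av]; case: eqP => [->|/eqP bv] // [].
  by apply: rkinj; rewrite in_setD1 ?av ?bv.
move=> w wU wU0; case: (w =P v) => [->|/eqP wv].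
  by apply: leq_trans vd; rewrite leq_mul2l subset_leq_card ?orbT //; apply/subsetP => p; rewrite inE => /andP[].
apply: leq_trans (H w _ wU0); last by rewrite in_setD1 wv.
rewrite leq_mul2l subset_leq_card ?orbT //; apply/subsetP => p; rewrite !inE.
case: (p.1 == v); rewrite //= ?andbF //; case: (p.2 == v); rewrite //= ?andbF //.
Qed.
End GreedyOrdering.

(** * A chordal model of an ordered graph *)

Section EliminationForest.
Variables (V : finType) (g : rel V) (rk : V -> nat).
Hypothesis gsym : forall u v, g u v = g v u.
Hypothesis rk_inj : injective rk.

Definition bad_cherry (a b c : V) : bool :=
  [&& rk a < rk b, rk b < rk c, g a b, g a c & ~~ g b c].

Definition good (R : {set V}) : bool :=
  [forall a in R, forall b in R, forall c in R, ~~ bad_cherry a b c].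

Lemma goodP (R : {set V}) :
  reflect (forall a b c, a \in R -> b \in R -> c \in R ->
             rk a < rk b -> rk b < rk c -> g a b -> g a c -> g b c) (good R).
Proof.
apply: (iffP forall_inP) => [H a b c aR bR cR ab bc gab gac|H a aR].
  have /forall_inP/(_ b bR)/forall_inP/(_ c cR) := H a aR.
  by rewrite /bad_cherry ab bc gab gac /= negbK.
apply/forall_inP => b bR; apply/forall_inP => c cR.
by apply/negP => /and5P[ab bc gab gac /negP[]]; apply: (H a).
Qed.

Lemma good_sub (P R : {set V}) : P \subset R -> good R -> good P.
Proof.
by move=> /subsetP PR /goodP H; apply/goodP => a b c /PR aR /PR bR /PR cR; apply: H.
Qed.

Lemma good_later (R : {set V}) a b c : good R -> a \in R -> b \in R -> c \in R ->
  rk a < rk b -> rk a < rk c -> g a b -> g a c -> b != c -> g b c.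
Proof.
move=> /goodP H aR bR cR ab ac gab gac bc.
case: (ltngtP (rk b) (rk c)) => [h|h|/rk_inj h]; last by rewrite h eqxx in bc.
  exact: (H a).
by rewrite gsym; apply: (H a).
Qed.

Definition up (R : {set V}) : rel V :=
  [rel a b | [&& a \in R, b \in R, rk a < rk b & g a b]].
(** Ancestors lie at higher rank. The relation is reflexive also outside [R]. *)
Definition anc (R : {set V}) (x t : V) : bool := connect (up R) x t.

Lemma up_anc R a b : up R a b -> anc R a b. Proof. exact: connect1. Qed.

Lemma anc_lt R x t : anc R x t -> x = t \/ (rk x < rk t /\ t \in R).
Proof.
move=> /connectP[p]; elim: p x => [|y p IH] x /=; first by left.
move=> /andP[/and4P[_ yR xy _] pP] tE; right; case: (IH y pP tE) => [<-|[]] //.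
by move=> yt tR; split=> //; apply: ltn_trans yt.
Qed.

Lemma anc_le R x t : anc R x t -> rk x <= rk t.
Proof. by case/anc_lt => [->//|[/ltnW]]. Qed.

Lemma anc_trans R x y z : anc R x y -> anc R y z -> anc R x z.
Proof. exact: connect_trans. Qed.

(** An increasing path only visits ranks between those of its ends, so deleting vertices outside
    this range does not break it. *)
Lemma anc_restrict (P R : {set V}) x t :
    (forall y, y \in R -> rk x <= rk y <= rk t -> y \in P) -> anc R x t -> anc P x t.
Proof.
move=> RP /connectP[p]; elim: p x RP => [|y p IH] x RP /=; first by move=> _ ->; apply: connect0.
move=> /andP[/and4P[xR yR xy gxy] pP] tE.
have yt : rk y <= rk t by apply: (@anc_le R); apply/connectP; exists p.
have xt : rk x <= rk t by apply: leq_trans yt; apply: ltnW.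
apply: (@connect_trans _ _ y); last first.
  apply: IH pP tE => z zR /andP[yz zt]; apply: RP => //.
  by rewrite zt andbT (leq_trans _ yz) // ltnW.
by apply: connect1; rewrite /up /= xy gxy !RP ?leqnn ?xt ?yt // ltnW.
Qed.

Lemma anc_sub (P R : {set V}) x t : P \subset R -> anc P x t -> anc R x t.
Proof. by move=> /subsetP PR; apply: anc_restrict => y /PR. Qed.

(** Compare [b] with the first step [d] of the path to [c]: both are later neighbours of [a], hence
    adjacent. If [b] comes first it reaches [c] through [d]; if [d] comes first, induct from [d]. *)
Lemma up_anc_chain R a b c : good R -> up R a b -> anc R a c ->
  [\/ a = c, anc R b c | anc R c b].
Proof.
move=> gR + /connectP[p]; elim: p a => [|d p IH] a /=; first by move=> _ _ ->; constructor 1.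
move=> uab /andP[uad pP] cE.
have dc : anc R d c by apply/connectP; exists p.
case/and4P: (uab) (uad) => aR bR ab gab /and4P[_ dR ad gad].
have [bd|bd] := eqVneq b d; first by rewrite bd; constructor 2.
have gbd := good_later gR aR bR dR ab ad gab gad bd.
case: (ltngtP (rk b) (rk d)) => [lt|lt|/rk_inj h]; last by rewrite h eqxx in bd.
  by constructor 2; apply: anc_trans dc; apply: up_anc; apply/and4P.
have udb : up R d b by apply/and4P; rewrite gsym.
by case: (IH d udb pP cE) => h; [constructor 3; rewrite -h; apply: up_anc|constructor 2|constructor 3].
Qed.

(** The forest property: the ancestors of a vertex form a chain. *)
Lemma anc_chain R a b c : good R -> anc R a b -> anc R a c -> anc R b c \/ anc R c b.
Proof.
move=> gR /connectP[p]; elim: p a => [|d p IH] a /=; first by move=> _ -> h; left.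
move=> /andP[uad pP] bE ac.
have db : anc R d b by apply/connectP; exists p.
case: (up_anc_chain gR uad ac) => h.
- by right; rewrite -h; apply: anc_trans db; apply: up_anc.
- exact: (IH d).
- by right; apply: anc_trans db.
Qed.

Definition below (R : {set V}) (w : V) : {set V} := [set x in R | (rk x < rk w) && g x w].
Definition descend (R : {set V}) (t : V) : {set V} := [set x in R | anc R x t].
(** The root of the heaviest branch of [below R w]. The default [w] occurs only when [below R w] is
    empty. *)
Definition top (R : {set V}) (w : V) : V :=
  odflt w [pick t in below R w | [forall u in below R w, #|descend R u| <= #|descend R t|]].
Definition branch (R : {set V}) (w : V) : {set V} := below R w :&: descend R (top R w).

Lemma in_below R w x : (x \in below R w) = [&& x \in R, rk x < rk w & g x w].
Proof. by rewrite inE. Qed.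

(** Each step leads to a later neighbour of a vertex that also has [w] as a later neighbour, hence
    again to a neighbour of [w]. *)
Lemma below_up R w x y : good (w |: R) -> x \in below R w -> anc R x y -> rk y < rk w ->
  y \in below R w.
Proof.
move=> gR + /connectP[p]; elim: p x => [|z p IH] x /=; first by move=> h _ ->.
rewrite in_below => /and3P[xR xw gxw] /andP[/and4P[_ zR xz gxz] pP] yE yw.
apply: (IH z) => //; rewrite in_below zR.
have zw : rk z < rk w.
  by apply: leq_ltn_trans yw; apply: (@anc_le R); apply/connectP; exists p.
rewrite zw /=; apply: (good_later gR (a := x)); rewrite ?inE ?eqxx ?xR ?zR ?orbT //.
by apply: contraTneq zw => ->; rewrite ltnn.
Qed.

Lemma topP R w x : x \in below R w -> top R w \in below R w /\
  (forall u, u \in below R w -> #|descend R u| <= #|descend R (top R w)|).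
Proof.
move=> xw; rewrite /top; case: pickP => [t /andP[tw /forall_inP tmax]|none] //=.
pose t := [arg max_(t > x in below R w) #|descend R t|].
suff : false by []; rewrite -(none t) /t; case: arg_maxnP => // i iw imax.
by rewrite iw; apply/forall_inP => u uw; apply: imax.
Qed.

Lemma descend_anc R t u : anc R t u -> descend R t \subset descend R u.
Proof.
move=> tu; apply/subsetP => x; rewrite !inE => /andP[-> xt] /=; exact: anc_trans tu.
Qed.

Lemma anc_antisym R x y : anc R x y -> anc R y x -> x = y.
Proof. by move=> /anc_lt[//|[xy _]] /anc_le; rewrite leqNgt xy. Qed.

Lemma top_maximal R w y : y \in below R w -> anc R (top R w) y -> y = top R w.
Proof.
move=> yw ty; have [tw tmax] := topP yw; apply/eqP/negPn/negP => yt.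
have yR : y \in R by move: yw; rewrite inE => /andP[].
suff /proper_card : descend R (top R w) \proper descend R y by rewrite ltnNge tmax.
apply/properP; split; first exact: descend_anc.
exists y; first by rewrite inE yR /anc connect0.
rewrite inE yR /=; apply: contra yt => yt.
by apply/eqP; apply: anc_antisym yt ty.
Qed.

Lemma in_branch R w x : (x \in branch R w) = (x \in below R w) && anc R x (top R w).
Proof. by rewrite !inE; case: (x \in R). Qed.

Lemma branch_top R w x : x \in branch R w -> top R w \in branch R w.
Proof.
by rewrite in_branch => /andP[xw _]; rewrite in_branch /anc connect0 andbT; case: (topP xw).
Qed.

(** Subtrees of a forest that meet contain the lower of their two roots: both roots are ancestors of
    [x], hence comparable. *)
Lemma branch_meet R v w x : good (w |: R) ->
    x \in branch R v -> x \in branch R w -> rk (top R v) <= rk (top R w) ->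
  top R v \in branch R w.
Proof.
move=> gR xv xw le.
have gR' : good R by apply: good_sub gR; apply: subsetUr.
have tw := branch_top xw.
move: xv xw tw; rewrite !in_branch => /andP[xv xtv] /andP[xw xtw] /andP[tw _].
have tvw : anc R (top R v) (top R w).
  case: (anc_chain gR' xtv xtw) => // h; case: (anc_lt h) => [->|[]]; first exact: connect0.
  by rewrite ltnNge le.
rewrite tvw andbT; apply: below_up xw xtv _ => //.
by apply: leq_ltn_trans le _; move: tw; rewrite in_below => /and3P[].
Qed.

Variables K k : nat.

(** Vertices represented by their branch: at least [K] earlier neighbours in [R], at most [k] of
    them off the main branch. *)
Definition settled (R : {set V}) (w : V) : bool :=
  [&& good (w |: R), K <= #|below R w| & #|below R w :\: branch R w| <= k].

Definition first_above (R : {set V}) (v z : V) : bool :=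
  [&& z \in R, rk v < rk z, g v z &
      [forall y in R, (rk v < rk y) && g v y ==> (rk z <= rk y)]].

(* [v], if not settled, becomes a simplicial vertex: its neighbours [w] are settled and all
   have in their branch the first neighbour of [v] in [R] above [v]. *)
Definition hangs (R : {set V}) (v w : V) : bool :=
  settled R w &&
  (if settled R v then ~~ [disjoint branch R v & branch R w]
   else [&& rk v < rk w, g v w & [exists z in branch R w, first_above R v z]]).

Definition model (R : {set V}) : rel V :=
  fun u v => (u != v) && (hangs R u v || hangs R v u).

Lemma model_simple R : simple_graph (model R).
Proof. by split=> [u v|u]; rewrite /model ?eqxx // eq_sym orbC. Qed.

Lemma first_above_uniq R v y z : first_above R v y -> first_above R v z -> y = z.
Proof.
move=> /and4P[yR vy gy /forall_inP yH] /and4P[zR vz gz /forall_inP zH]; apply: rk_inj.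
have := yH z zR; have := zH y yR; rewrite vy gy vz gz /=; lia.
Qed.

Lemma model_settled R u v : settled R u -> settled R v -> u != v ->
  model R u v = ~~ [disjoint branch R u & branch R v].
Proof.
move=> su sv uv; rewrite /model /hangs su sv uv /= (disjoint_sym (mem (branch R v))) orbb //.
Qed.

Lemma model_common R u v x : settled R u -> settled R v -> u != v ->
  x \in branch R u -> x \in branch R v -> model R u v.
Proof.
move=> su sv uv xu xv; rewrite model_settled //; apply/negP => /disjointFr/(_ xu).
by rewrite xv.
Qed.

(** Every vertex set has a simplicial vertex: an unsettled one if there is any, as the branches of
    its neighbours share a point; otherwise the one whose [top] has least rank, as by [branch_meet]
    this [top] lies in the branches of all its neighbours. *)
Lemma model_chordal R : chordal (model R).
Proof.
apply: chordal_of_simplicial => Q /set0Pn[v0 v0Q].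
have [/existsP[v /andP[vQ nv]]|/existsPn allok] := boolP [exists v in Q, ~~ settled R v].
  exists v => //; apply/simplicial_inP => a b aQ bQ.
  have H c : model R v c -> settled R c /\ exists2 z, z \in branch R c & first_above R v z.
    case/andP => _; rewrite /hangs (negPf nv) /= orbF => /and4P[sc _ _ /existsP[z /andP[zc fz]]].
    by split=> //; exists z.
  move=> /H[sa [y ya fy]] /H[sb [z zb fz]] ab.
  by apply: (model_common sa sb ab ya); rewrite (first_above_uniq fy fz).
have ok v : v \in Q -> settled R v by move=> vQ; have := allok v; rewrite vQ negbK.
have [v vQ vmin] := arg_minnP (fun v => rk (top R v)) v0Q.
exists v => //; apply/simplicial_inP => a b aQ bQ.
have H c : c \in Q -> model R v c -> top R v \in branch R c.
  move=> cQ vc; have vnc : v != c by case/andP: vc.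
  move: vc; rewrite (model_settled (ok _ vQ) (ok _ cQ) vnc) => /pred0Pn[x /andP[xv xc]].
  by apply: branch_meet xv xc (vmin _ cQ); case/and3P: (ok _ cQ).
by move=> /(H _ aQ) ya /(H _ bQ) yb ab; apply: model_common ya yb => //; apply: ok.
Qed.

Definition few_below (R : {set V}) w := #|below R w| < K.
Definition split_below R w := k < #|below R w :\: branch R w|.
Definition apart R v w :=
  [&& settled R v, settled R w & [disjoint branch R v & branch R w]].
Definition none_before (R : {set V}) v w := [forall z in R, (rk v < rk z) && g v z ==> (rk w < rk z)].
Definition strays R v w :=
  settled R w && [exists z in below R w :\: branch R w, first_above R v z].

(** The model creates no new edge here: two branches that meet give a common earlier neighbour, and
    without bad cherries this makes [v] and [w] adjacent. A lost edge has one of five causes: [w] is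
    unsettled in one of two ways, both are settled but apart, or the first later neighbour of an
    unsettled [v] comes too late or lies off the branch of [w]. *)
Lemma model_error R v w : good (v |: (w |: R)) -> v \notin R -> w \notin R ->
    rk v < rk w -> g v w != model R v w ->
  g v w && [|| few_below R w, (K <= #|below R w|) && split_below R w, apart R v w,
              none_before R v w | strays R v w].
Proof.
move=> gR vR wR vw.
have vnw : v != w by apply: contraTneq vw => ->; rewrite ltnn.
have nwv : hangs R w v -> settled R w && hangs R v w.
  rewrite /hangs; case: (settled R w); last by rewrite ltnNge (ltnW vw) /= andbF.
  by rewrite disjoint_sym /= => /andP[->].
have gw : good (w |: R) by apply: good_sub gR; apply: subsetUr.
rewrite /model vnw /=; case: (boolP (g v w)) => gvw /=; last first.
  have E : hangs R v w || hangs R w v -> hangs R v w by case/orP => // /nwv /andP[].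
  rewrite eq_sym eqbF_neg negbK => /E; rewrite /hangs => /andP[sw].
  case: ifP => [sv|_]; last by rewrite (negPf gvw) andbF.
  case/pred0Pn => x /andP[]; rewrite /= !in_branch !in_below => /andP[/and3P[xR xv gxv] _] /andP[/and3P[_ xw gxw] _].
  case/negP: gvw; apply: (good_later gR (a := x)); rewrite ?inE ?eqxx ?xR ?orbT //.
rewrite eq_sym eqb_id negb_or => /andP[nh _].
case: (boolP (settled R w)) => [sw|]; last first.
  rewrite /settled gw /= negb_and -ltnNge -ltnNge => /orP[h|h]; first by rewrite /few_below h.
  by case: (leqP K #|below R w|) => h2; rewrite /few_below /split_below ?h2 ?h ?orbT //.
rewrite /apart /strays sw; move: nh; rewrite /hangs sw /=; case: ifP => sv.
  by rewrite negbK => ->; rewrite !orbT.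
rewrite vw gvw /= => nz.
have [nb|/forall_inPn[z0 z0R]] := boolP (none_before R v w); first by rewrite !orbT.
rewrite negb_imply -leqNgt => /andP[z0P z0w].
have [z /andP[zR /andP[vz gvz]] zmin] := @arg_minnP _ z0 (fun z => (z \in R) && ((rk v < rk z) && g v z)) rk (introT andP (conj z0R z0P)).
have fz : first_above R v z.
  apply/and4P; split=> //; apply/forall_inP => y yR; apply/implyP => yP; apply: zmin; by rewrite yR.
have zw : rk z < rk w.
  rewrite ltn_neqAle (leq_trans (zmin _ _) z0w) ?z0R // andbT.
  by apply: contra wR => /eqP/rk_inj <-.
apply/orP; right; apply/orP; right; rewrite /=; apply/existsP; exists z; rewrite fz andbT in_setD.
apply/andP; split; first by apply: contra nz => zb; apply/existsP; exists z; rewrite zb.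
rewrite in_below zR zw /=.
apply: (good_later gR (a := v)); rewrite ?inE ?eqxx ?zR ?orbT //.
by apply: contraTneq zw => ->; rewrite ltnn.
Qed.

(** * Counting each kind of error inside a fixed set *)

Definition before (v w : V) := [&& v != w, rk v < rk w & g v w].

Lemma below_del (P : {set V}) v w : below (P :\ v :\ w) w = below P w :\ v.
Proof.
apply/setP => x; rewrite !inE; case: (x =P w) => [->|_]; last by case: (x == v).
by rewrite ltnn !andbF.
Qed.

Lemma below_del1 (P : {set V}) w : below (P :\ w) w = below P w.
Proof.
by apply/setP => x; rewrite !inE; case: (x =P w) => [->|_] //; rewrite ltnn !andbF.
Qed.

Lemma anc_del (P : {set V}) w x t : rk t < rk w -> anc (P :\ w) x t = anc P x t.
Proof.
move=> tw; apply/idP/idP; first by apply: anc_sub; apply: subD1set.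
apply: anc_restrict => y yP /andP[_ yt]; rewrite in_setD1 yP andbT.
by apply: contraTneq tw => <-; rewrite -leqNgt.
Qed.

Lemma descend_del (P : {set V}) w t : rk t < rk w -> descend (P :\ w) t = descend P t.
Proof.
move=> tw; apply/setP => x; rewrite !inE anc_del //; case: (x =P w) => [->|_] //=.
by rewrite andbC; case: (boolP (anc P w t)) => //= /anc_le; rewrite leqNgt tw.
Qed.

Lemma before_below (P : {set V}) v w : v \in P -> before v w -> v \in below P w.
Proof. by move=> vP /and3P[_ vw gvw]; rewrite in_below vP vw. Qed.

(** All counted [v] lie in [below P w]. A single one of them bounds this set, since it has just one
    element more than after the deletion of [v]. *)
Lemma card_few_below (P : {set V}) w :
  #|[set v in P | before v w && few_below (P :\ v :\ w) w]| <= K.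
Proof.
set A := [set _ in _ | _]; have [->|[v]] := set_0Vmem A; first by rewrite cards0.
rewrite inE /few_below below_del => /and3P[vP vw lt].
have := cardsD1 v (below P w); rewrite (before_below vP vw) add1n => E.
apply: leq_trans (_ : #|below P w| <= _); last by rewrite E.
by apply: subset_leq_card; apply/subsetP => u; rewrite inE => /and3P[uP uw _]; apply: before_below.
Qed.

(** Of two such [w], each survives the deletion of the other, so each would have to precede the
    other. *)
Lemma card_none_before (P : {set V}) v :
  #|[set w in P | before v w && none_before (P :\ v :\ w) v w]| <= 1.
Proof.
apply/card_le1_eqP => w1 w2; rewrite !inE => /and3P[w1P /and3P[n1 v1 g1] N1] /and3P[w2P /and3P[n2 v2 g2] N2].
have H a b : a \in P -> v != a -> rk v < rk a -> g v a ->
    none_before (P :\ v :\ b) v b -> a != b -> rk b < rk a.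
  move=> aP va vla gva /forall_inP/(_ a); rewrite !in_setD1 aP [a == v]eq_sym va vla gva andbT /=.
  by move=> h ab; apply: h; rewrite ab.
apply/eqP/negPn/negP => w12.
have := H _ _ w2P n2 v2 g2 N1 w12; rewrite eq_sym in w12; have := H _ _ w1P n1 v1 g1 N2 w12.
lia.
Qed.

Section Light.
Variable P : {set V}.
Hypothesis gP : good P.

(** As in a heavy-light decomposition, [w] charges its earlier neighbours off the heaviest
    branch. *)
Let light w := below P w :\: branch (P :\ w) w.

Lemma lightP w x : x \in light w -> exists t,
  [/\ t \in below P w, x \in below P w, ~~ anc P x t,
      forall u, u \in below P w -> #|descend P u| <= #|descend P t| &
      forall u, u \in below P w -> anc P t u -> u = t].
Proof.
rewrite in_setD in_branch below_del1 => /andP[+ xw]; rewrite xw /= => nx.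
have xw' : x \in below (P :\ w) w by rewrite below_del1.
have [tw tmax] := topP xw'; rewrite below_del1 in tw.
have rkw u : u \in below P w -> rk u < rk w by rewrite in_below => /and3P[].
exists (top (P :\ w) w); split=> //.
- by rewrite -(@anc_del P w) ?rkw.
- by move=> u uw; have := tmax u; rewrite below_del1 !descend_del ?rkw //; apply.
- by move=> u uw tu; apply: top_maximal; rewrite ?below_del1 // anc_del ?rkw.
Qed.

(* Passing from one vertex charging [x] to the next at least doubles the subtree:
   the branch containing [x] was not the heaviest one. *)
Lemma light_double x w1 w2 : rk w1 < rk w2 -> w1 \in P -> w2 \in P ->
  x \in light w1 -> x \in light w2 -> 2 * #|descend P w1| <= #|descend P w2|.
Proof.
move=> lt w1P w2P /lightP[_ [_ xw1 _ _ _]] /lightP[t [tw xw2 nxt tmax ttop]].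
move: (xw1) (xw2) (tw); rewrite !in_below => /and3P[xP x1 gx1] /and3P[_ x2 gx2] /and3P[tP t2 gt2].
have w12 : w1 != w2 by apply: contraTneq lt => ->; rewrite ltnn.
have g12 : g w1 w2 by apply: (good_later gP (a := x)).
have w1w2 : w1 \in below P w2 by rewrite in_below w1P lt.
have ux1 : up P x w1 by apply/and4P.
have disj : [disjoint descend P w1 & descend P t].
  apply/pred0P => y /=; apply/negP => /andP[]; rewrite !inE => /andP[yP y1] /andP[_ yt].
  case: (anc_chain gP y1 yt) => h.
    by case/negP: nxt; apply: anc_trans h; apply: up_anc.
  by case/negP: nxt; rewrite -(ttop _ w1w2 h); apply: up_anc.
rewrite mul2n -addnn; apply: leq_trans (leq_add (leqnn _) (tmax _ w1w2)) _.
rewrite -cardsUI (disjoint_setI0 disj) cards0 addn0 subset_leq_card // subUset.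
by rewrite !descend_anc // up_anc //; apply/and4P.
Qed.

(** Iterates [light_double] along the vertices charging [x]; for the first one the subtree already
    contains [x] and [w]. *)
Lemma light_exp x w : w \in P -> x \in light w ->
  2 ^ #|[set u in P | (x \in light u) && (rk u <= rk w)]| <= #|descend P w|.
Proof.
have [n] := ubnP (rk w); elim: n w => // n IH w; rewrite ltnS => wn wP xw.
set W := [set _ in _ | _]; pose W' := [set u in P | (x \in light u) && (rk u < rk w)].
have WE : W = w |: W'.
  apply/setP => u; rewrite in_setU1 [u \in W]inE [u \in W']inE leq_eqVlt.
  case: (u =P w) => [->|uw]; first by rewrite wP xw eqxx.
  by case: eqP => // /rk_inj.
have cW : #|W| = #|W'|.+1 by rewrite WE cardsU1 inE ltnn !andbF.
have [W0|[u0 u0W]] := set_0Vmem W'.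
  rewrite cW W0 cards0 expn1; have [t [_ xw' _ _ _]] := lightP xw.
  move: xw'; rewrite in_below => /and3P[xP xlw gxw].
  rewrite (_ : 2 = #|[set x; w]|); last first.
    by rewrite cards2; case: eqP => // E; rewrite E ltnn in xlw.
  apply: subset_leq_card; apply/subsetP => z; rewrite !inE => /orP[]/eqP->.
    by rewrite xP up_anc //; apply/and4P.
  by rewrite wP /anc connect0.
have [u uW umax] := arg_maxnP rk u0W; move: (uW : u \in W'); rewrite [u \in W']inE => /and3P[uP xu uw].
have := light_double uw uP wP xu xw; apply: leq_trans; rewrite cW expnS leq_pmul2l //.
apply: leq_trans (IH u _ uP xu); last by apply: leq_trans wn.
rewrite leq_exp2l // subset_leq_card //; apply/subsetP => z zW; have := umax _ zW.
by move: zW; rewrite !inE => /and3P[-> -> _] /= ->.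
Qed.

(** Double counting of charges: each split [w] makes more than [k], while each [x] receives fewer
    than [s], as its charges double a subtree of size below [2 ^ s]. *)
Lemma card_split_below s : #|P| < 2 ^ s ->
  #|[set w in P | split_below (P :\ w) w]| * k <= #|P| * s.
Proof.
move=> Ps; set W := [set _ in _ | _].
apply: leq_trans (_ : \sum_(w in W) #|light w| <= _).
  rewrite -sum_nat_const; apply: leq_sum => w; rewrite inE /split_below below_del1 => /andP[_].
  exact: ltnW.
apply: leq_trans (_ : \sum_(w in W) \sum_(x in P) (x \in light w) <= _).
  apply: leq_sum => w _; rewrite -sum1_card big_mkcond [X in _ <= X]big_mkcond /=.
  apply: leq_sum => x _; case: ifP => // xw.
  by move: (xw); rewrite in_setD in_below => /andP[_ /andP[-> _]].
rewrite exchange_big /= -sum_nat_const; apply: leq_sum => x xP.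
rewrite -big_mkcondr /= sum1dep_card.
set Wx := [set _ | _].
have [->|[w0 w0W]] := set_0Vmem Wx; first by rewrite cards0.
have [w wW wmax] := arg_maxnP rk w0W; move: (wW : w \in Wx); rewrite [w \in Wx]inE => /andP[+ xw]; rewrite inE => /andP[wP _].
have := light_exp wP xw => h; have {}h := leq_ltn_trans h (leq_ltn_trans (subset_leq_card _) Ps).
have : 2 ^ #|Wx| < 2 ^ s.
  apply: leq_ltn_trans (h _); last by apply/subsetP => z; rewrite inE => /andP[].
  rewrite leq_exp2l // subset_leq_card //; apply/subsetP => z zW; have := wmax _ zW.
  by move: zW; rewrite !inE => /andP[/andP[-> _] ->] /= ->.
by rewrite ltn_exp2l // => /ltnW.
Qed.
End Light.

Section Apart.
Variables (P : {set V}) (w : V).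
Hypotheses (gP : good P) (wP : w \in P).

(* If [x] is below several such [v], these are pairwise adjacent (no bad cherry), and only
   [2 k] of the others can be neighbours of the last one without linking the two branches. *)
Lemma card_apart :
  #|[set v in P | before v w && apart (P :\ v :\ w) v w]| * K <= #|P| * (2 * k).+1.
Proof.
set B := [set _ in _ | _].
have belowE v : before v w -> below (P :\ v :\ w) v = below P v.
  case/and3P => nvw vw gvw; apply/setP => x; rewrite !inE.
  case: (x =P v) => [->|_] /=; first by rewrite ltnn !andbF.
  by case: (x =P w) => [->|_] //=; rewrite ltnNge (ltnW vw) !andbF.
apply: leq_trans (_ : \sum_(v in B) #|below P v| <= _).
  rewrite -sum_nat_const; apply: leq_sum => v; rewrite inE => /and3P[vP vw /and3P[/and3P[_ h _] _ _]].
  by rewrite -belowE.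
apply: leq_trans (_ : \sum_(v in B) \sum_(x in P) (x \in below P v) <= _).
  apply: leq_sum => v _; rewrite -sum1_card big_mkcond [X in _ <= X]big_mkcond /=.
  by apply: leq_sum => x _; case: ifP => // xv; move: (xv); rewrite in_below => /andP[-> _].
rewrite exchange_big /= -sum_nat_const; apply: leq_sum => x xP.
rewrite -big_mkcondr /= sum1dep_card; set Y := [set _ | _].
have [->|[v0 v0Y]] := set_0Vmem Y; first by rewrite cards0.
have [v vY vmax] := arg_maxnP rk v0Y.
move: (vY : v \in Y); rewrite [v \in Y]inE => /andP[+ +]; rewrite [v \in B]inE in_below => /and3P[vP vw av] /and3P[_ xv gxv].
pose R := P :\ v :\ w.
have Ysub : Y \subset v |: ((below R v :\: branch R v) :|: (below R w :\: branch R w)).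
  apply/subsetP => u uY; have uv := vmax _ uY.
  move: uY; rewrite [u \in Y]inE => /andP[+ +]; rewrite [u \in B]inE in_below => /and3P[uP uw _] /and3P[_ xu gxu].
  rewrite in_setU1; have [//|unv] := eqVneq u v; rewrite /= in_setU !in_setD.
  have ltuv : rk u < rk v.
    by rewrite ltn_neqAle [X in _ && X]uv andbT; apply: contra unv => /eqP/rk_inj ->.
  case/and3P: (uw) => unw ltuw guw.
  have guv : g u v by apply: (good_later gP (a := x)).
  have -> : u \in below R v by rewrite in_below !in_setD1 unw unv uP ltuv.
  have -> : u \in below R w by rewrite in_below !in_setD1 unw unv uP ltuw.
  rewrite !andbT -negb_and; apply/negP => /andP[b1 b2].
  by case/and3P: av => _ _ /disjointFr/(_ b1); rewrite b2.
case/and3P: av => /and3P[_ _ c1] /and3P[_ _ c2] _.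
apply: leq_trans (subset_leq_card Ysub) _; rewrite cardsU1.
have [cr _] := leq_card_setU (below R v :\: branch R v) (below R w :\: branch R w).
apply: leq_trans (leq_add (leq_b1 _) (leq_trans cr (leq_add c1 c2))) _.
by clear; lia.
Qed.
End Apart.

Section Strays.
Variables (P : {set V}) (w : V).
Hypotheses (gP : good P) (wP : w \in P) (Kk : 2 * k + 2 <= K).

Let R v := P :\ v :\ w.
Let D := [set v in P | before v w && strays (R v) v w].
Let rest v := below (R v) w :\: branch (R v) w.

Lemma in_rest v y :
  y \notin branch (R v) w -> y != v -> y \in below P w -> y \in rest v.
Proof. by move=> yb yv yX; rewrite in_setD yb /R below_del in_setD1 yv. Qed.

Lemma strayP v : v \in D -> [/\ v \in below P w, v != w, K <= #|below P w :\ v|, #|rest v| <= k &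
  exists z, [/\ z \in rest v, rk v < rk z & g v z]].
Proof.
rewrite inE => /and4P[vP vw /and3P[_ c1 c2] /existsP[z /andP[zr /and4P[_ vz gvz _]]]].
split=> //; [exact: before_below|by case/and3P: vw|by rewrite -below_del|by exists z].
Qed.

(* If [v] stays in the main branch after deleting [v0], then [v] is what separates
   the main branch of [R v] from [z], so that this branch lies entirely below [v]. *)
Lemma stray_high v0 v : v0 \in D -> v \in D -> rk v0 < rk v -> v \in branch (R v0) w ->
  forall x, x \in branch (R v) w -> rk x < rk v.
Proof.
move=> v0D vD v0v vb0.
have [v0X nv0w cX0 c0 _] := strayP v0D.
have [vX nvw cX c [z [zr vz gvz]]] := strayP vD.
have gY : good (P :\ w) by apply: good_sub gP; apply: subD1set.
have subY u : R u \subset P :\ w by apply: setSD; apply: subD1set.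
have gR u : good (R u) by apply: good_sub gY.
have inR u y : (y \in R u) = [&& y != w, y != u & y \in P] by rewrite !in_setD1.
have aboveR u y (t : V) : y \in P :\ w -> rk u < rk t -> rk t <= rk y -> y \in R u.
  rewrite in_setD1 inR => /andP[-> ->] ut ty; rewrite andbT /=.
  by apply: contraTneq (leq_trans ut ty) => ->; rewrite ltnn.
move: (zr); rewrite in_setD in_branch => /andP[+ zb]; rewrite zb /= => nzt.
move: (zb); rewrite in_below => /and3P[zR zw gzw].
have zY : z \in P :\ w by apply: (subsetP (subY v)).
have z0 : z \in R v0 by apply: aboveR zY v0v (ltnW vz).
have zb0 : z \in below (R v0) w by rewrite in_below z0 zw.
have vR0 : v \in R v0.
  by move: vb0; rewrite in_branch in_below => /andP[/andP[]].
set t0 := top (R v0) w; set t := top (R v) w.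
have vt0 : anc (R v0) v t0 by move: vb0; rewrite in_branch => /andP[].
have uvz : up (R v0) v z by apply/and4P.
(* Both [z] and [t0] are reached from [v], hence comparable, and [t0] is maximal below [w]. *)
have zt0 : anc (R v0) z t0.
  case: (up_anc_chain (gR v0) uvz vt0) => // [E|/(top_maximal zb0)->]; last exact: connect0.
  by have := @top_maximal (R v0) w z zb0; rewrite -/t0 -E => -> //; [exact: connect0|exact: up_anc].
have zt0' : anc (R v) z t0.
  by apply: anc_restrict zt0 => y yR /andP[zy _]; apply: aboveR vz zy; apply: (subsetP (subY v0)).
have zlt0 : rk z <= rk t0 := anc_le zt0.
have vlt0 : rk v < rk t0 by apply: leq_trans zlt0.
have t0b : t0 \in below (R v) w.
  have [+ _] := topP zb0; rewrite -/t0 !in_below => /andP[t0R ->]; rewrite andbT.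
  by apply: aboveR vz zlt0; apply: (subsetP (subY v0)).
(* If the branches were disjoint, all of [below P w] except [v] and [v0] would lie in [rest v] or
   [rest v0]: at most [2 * k + 2] vertices, yet there are at least [K + 1]. *)
have [s sv sv0] : exists2 s, s \in branch (R v) w & s \in branch (R v0) w.
  have [/exists_inP //|/exists_inPn none] :=
    boolP [exists s in branch (R v) w, s \in branch (R v0) w].
  exfalso.
  have Xsub : below P w \subset v |: (v0 |: (rest v :|: rest v0)).
    apply/subsetP => y yX; apply/setU1P; have [->|yv] := eqVneq y v; [by left|right].
    apply/setU1P; have [->|yv0] := eqVneq y v0; [by left|right].
    apply/setUP; case/orP: (orbN (y \in branch (R v) w)) => yb; [right|left].
      exact: in_rest (none y yb) yv0 yX.
    exact: in_rest yb yv yX.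
  have cv := cardsD1 v (below P w); rewrite vX in cv.
  have cX' := subset_leq_card Xsub; rewrite !cardsU1 in cX'.
  have [cr _] := leq_card_setU (rest v) (rest v0).
  have [b1 b2] := (leq_b1 (v \notin v0 |: (rest v :|: rest v0)), leq_b1 (v0 \notin rest v :|: rest v0)).
  move: (leq_trans cX' (leq_add b1 (leq_add b2 (leq_trans cr (leq_add c c0))))).
  rewrite cv; move: cX Kk; clear; lia.
have st : anc (P :\ w) s t by apply: anc_sub (subY v) _; move: sv; rewrite in_branch => /andP[].
have st0 : anc (P :\ w) s t0 by apply: anc_sub (subY v0) _; move: sv0; rewrite in_branch => /andP[].
(* As ancestors of [s], the two tops are comparable. If [t0] were under [t], then [z] would be too,
   and would not stray; the same holds if [t] came after [v], since then [t = t0]. *)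
case: (anc_chain gY st0 st) => [t0t|tt0].
  case/negP: nzt; apply: anc_trans zt0' _.
  by apply: anc_restrict t0t => y yY /andP[ty _]; apply: aboveR vlt0 ty.
have tR : t \in R v by have := branch_top sv; rewrite in_branch in_below => /andP[/andP[]].
have tv : rk t < rk v.
  case: (ltngtP (rk t) (rk v)) => // [vt|/rk_inj tE]; last by move: tR; rewrite tE inR eqxx andbF.
  have tE : t0 = t.
    apply: top_maximal t0b _.
    by apply: anc_restrict tt0 => y yY /andP[ty _]; apply: aboveR vt ty.
  by case/negP: nzt; move: zt0'; rewrite tE.
by move=> x; rewrite in_branch => /andP[_ /anc_le xt]; apply: leq_ltn_trans tv.
Qed.

(** Let [v0] be the first stray. At most [k] others leave the main branch of [R v0]. For any further
    [v], by [stray_high] every element of [below P w] from [v] on is [v] or off the branch, so [v]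
    is among the last [k.+1] elements. *)
Lemma card_strays : #|D| <= 2 * k + 2.
Proof.
have [->|[v1 v1D]] := set_0Vmem D; first by rewrite cards0.
have [v0 v0D v0min] := arg_minnP rk v1D.
pose tail v := [set y in below P w | rk v <= rk y].
pose H := [set v in below P w | #|tail v| <= k.+1].
have cH : #|H| <= k.+1.
  have [->|[u1 u1H]] := set_0Vmem H; first by rewrite cards0.
  have [u uH umin] := arg_minnP rk u1H.
  move: (uH : u \in H); rewrite [u \in H]inE => /andP[_]; apply: leq_trans.
  apply: subset_leq_card; apply/subsetP => y yH; rewrite inE umin // andbT.
  by move: yH; rewrite inE => /andP[].
have Dsub : D \subset v0 |: (rest v0 :|: H).
  apply/subsetP => v vD; have [vX _ _ c _] := strayP vD.
  apply/setU1P; have [->|vv0] := eqVneq v v0; [by left|right].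
  have v0v : rk v0 < rk v.
    by rewrite ltn_neqAle [X in _ && X]v0min // andbT; apply: contra vv0 => /eqP/rk_inj ->.
  apply/setUP; case/orP: (orbN (v \in branch (R v0) w)) => vb; [right|left]; last first.
    exact: in_rest vb vv0 vX.
  have high := stray_high v0D vD v0v vb.
  suff vt : #|tail v| <= k.+1 by rewrite inE vX.
  apply: leq_trans (_ : #|v |: rest v| <= _); last by rewrite cardsU1; exact: leq_add (leq_b1 _) c.
  apply: subset_leq_card; apply/subsetP => y; rewrite [y \in tail v]inE => /andP[yX vy].
  apply/setU1P; have [->|yv] := eqVneq y v; [by left|right].
  by apply: in_rest yv yX; apply/negP => /high; rewrite ltnNge vy.
have [_ _ _ c0 _] := strayP v0D.
apply: leq_trans (subset_leq_card Dsub) _; rewrite cardsU1.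
have [+ _] := leq_card_setU (rest v0) H.
move=> cr; apply: leq_trans (leq_add (leq_b1 _) (leq_trans cr (leq_add c0 cH))) _.
by clear; lia.
Qed.
End Strays.
End EliminationForest.

(** * Averaging over random subsets *)

Section SubsetSums.
Variable V : finType.

(** The pairs of a set and a point of it correspond to the pairs of a set and a point outside it, by
    deleting the point. *)
Lemma sum_subsets_del1 (F : {set V} -> V -> nat) j :
  \sum_(A : {set V} | #|A| == j.+1) \sum_(v in A) F (A :\ v) v =
  \sum_(A : {set V} | #|A| == j) \sum_(v | v \notin A) F A v.
Proof.
rewrite !pair_big_dep /=.
rewrite (reindex_onto (fun p : {set V} * V => (p.2 |: p.1, p.2))
                      (fun p : {set V} * V => (p.1 :\ p.2, p.2))) /=; last first.
  by move=> [A v] /= /andP[_ vA]; rewrite setD1K.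
apply: eq_big => [[A v]|[A v]] /=.
  rewrite setU11 cardsU1; case: (boolP (v \in A)) => vA /=; rewrite ?andbF ?andbT.
    by apply/negbTE; apply/negP => /andP[_ /eqP[E]]; move: vA; rewrite -E setD11.
  by rewrite setU1K // eqxx andbT add1n eqSS.
by move=> /andP[_ /eqP[->]].
Qed.

Lemma sum_subsets_del2 (F : {set V} -> V -> V -> nat) j :
  \sum_(A : {set V} | #|A| == j.+2) \sum_(v in A) \sum_(w in A :\ v) F (A :\ v :\ w) v w =
  \sum_(A : {set V} | #|A| == j) \sum_(w | w \notin A) \sum_(v | v \notin w |: A) F A v w.
Proof.
rewrite (sum_subsets_del1 (fun A v => \sum_(w in A) F (A :\ w) v w)).
rewrite -(sum_subsets_del1 (fun A w => \sum_(v | v \notin w |: A) F A v w)).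
apply: eq_bigr => A _; rewrite exchange_big /=; apply: eq_bigr => w wA.
by rewrite setD1K.
Qed.

Lemma card_subsets j : #|[pred A : {set V} | #|A| == j]| = 'C(#|V|, j).
Proof.
by rewrite -cardsT -(cards_draws [set: V] j); apply: eq_card => A; rewrite !inE ?subsetT.
Qed.

Lemma card_supersets (T : {set V}) j :
  #|[set A : {set V} | (#|A| == #|T| + j) && (T \subset A)]| <= 'C(#|V| - #|T|, j).
Proof.
have -> : #|V| - #|T| = #|~: T| by rewrite -(cardsC T) addKn.
rewrite -(cards_draws (~: T) j) -(card_in_imset (f := fun A : {set V} => A :\: T)).
  apply: subset_leq_card; apply/subsetP => _ /imsetP[A + ->]; rewrite !inE => /andP[/eqP cA TA].
  by rewrite setDE subsetIr /= -setDE cardsD (setIidPr TA) cA addKn.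
move=> A B; rewrite !inE => /andP[_ TA] /andP[_ TB] E.
by rewrite -(setID A T) -(setID B T) E (setIidPr TA) (setIidPr TB).
Qed.
End SubsetSums.

(** * Averaging the errors to find one good sample *)

Section Removal.
Variables (V : finType) (g : rel V) (rk : V -> nat).
Hypothesis gsym : forall u v, g u v = g v u.
Hypothesis rk_inj : injective rk.

Let n := #|V|.
Variables (E s k K m d : nat).
Let N := m.+2.
Hypotheses (E0 : 0 < E) (s0 : 0 < s) (n4 : 3 < n) (Nn : N <= n) (m0 : 0 < m).
Hypotheses (kH : 16 * E * s <= k) (KH : 16 * E * (2 * k).+1 <= K)
  (NH : 16 * E * (K + 2 * k + 3) <= N) (sH : N < 2 ^ s) (dH : 16 * E * N ^ 3 <= d).

Definition cherries : {set V * V * V} :=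
  [set t | bad_cherry g rk t.1.1 t.1.2 t.2].
Hypothesis few_cherries : d * #|cherries| <= n ^ 3.

(** Union bound: a cherry lies in ['C(n - 3, N - 3)] of the [N]-sets, a proportion of at most 8 N^3
    / n^3, and [dH] beats the factor [16 * E * N ^ 3]. *)
Lemma card_not_good :
  2 * E * #|[set A : {set V} | (#|A| == N) && ~~ good g rk A]| <= 'C(n, N).
Proof.
set NG := [set _ | _].
have NB : #|NG| <= #|cherries| * 'C(n - 3, N - 3).
  pose T (t : V * V * V) := [set t.1.1; t.1.2; t.2].
  have cT t : t \in cherries -> #|T t| = 3.
    rewrite inE => /and5P[ab bc _ _ _].
    have nab : t.1.1 != t.1.2 by apply: contraTneq ab => ->; rewrite ltnn.
    have nbc : t.1.2 != t.2 by apply: contraTneq bc => ->; rewrite ltnn.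
    have nac : t.1.1 != t.2 by apply: contraTneq (ltn_trans ab bc) => ->; rewrite ltnn.
    by rewrite /T cardsU cards2 nab cards1 (_ : _ :&: _ = set0) ?cards0 //; apply/setP => x;
      rewrite !inE; apply/negP => /andP[/orP[]/eqP-> /eqP h]; [rewrite h eqxx in nac|rewrite h eqxx in nbc].
  apply: leq_trans (_ : #|\bigcup_(t in cherries) [set A : {set V} | (#|A| == #|T t| + (N - 3)) && (T t \subset A)]| <= _).
    apply: subset_leq_card; apply/subsetP => A; rewrite inE => /andP[/eqP cA].
    case/forall_inPn => a aA /forall_inPn[b bA /forall_inPn[c cA' ]]; rewrite negbK => bad.
    have bad' : (a, b, c) \in cherries by rewrite inE.
    apply/bigcupP; exists (a, b, c) => //; rewrite inE cT // cA /T /= !subUset !sub1set aA bA cA' /= andbT.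
    by rewrite /N; lia.
  apply: leq_trans (card_bigcup_leq _ _) _; rewrite -sum_nat_const; apply: leq_sum => t tc.
  by apply: leq_trans (card_supersets _ _) _; rewrite cT.
have CE : N * N.-1 * N.-2 * 'C(n, N) = n * n.-1 * n.-2 * 'C(n - 3, N - 3).
  move: n4 m0; rewrite /N; case: n => [|[|[|n']]] //; case: (m) => // m' _ _ /=.
  rewrite !subSS !subn0.
  have := mul_bin_diag n'.+3 m'.+2; have := mul_bin_diag n'.+2 m'.+1; have := mul_bin_diag n'.+1 m' => /=.
  move: 'C(n', m') 'C(n'.+1, m'.+1) 'C(n'.+2, m'.+2) 'C(n'.+3, m'.+3) => c0 c1 c2 c3 h1 h2 h3.
  transitivity (m'.+2 * m'.+1 * (m'.+3 * c3)); first by lia.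
  rewrite -h3; transitivity (n'.+3 * m'.+1 * (m'.+2 * c2)); first by lia.
  by rewrite -h2; transitivity (n'.+3 * n'.+2 * (m'.+1 * c1)); [lia|rewrite -h1; lia].
have n3 : n ^ 3 <= 8 * (n * n.-1 * n.-2).
  by move: n4; case: n => [|[|[|n']]] //= _; nia.
have pos : 0 < d * (n * n.-1 * n.-2).
  rewrite muln_gt0; apply/andP; split; last by move: n4; case: n => [|[|[|n']]].
  by apply: leq_trans dH; rewrite !muln_gt0 E0.
rewrite -(leq_pmul2l pos).
set Z := n * n.-1 * n.-2 in CE n3 pos *; set c := 'C(n, N) in CE *; set c' := 'C(n - 3, N - 3) in CE NB.
have N3 : N * N.-1 * N.-2 <= N ^ 3 by rewrite /N /=; nia.
apply: leq_trans (_ : 2 * E * n ^ 3 * (Z * c') <= _).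
  have := leq_mul few_cherries (leqnn (2 * E * Z * c')); have := leq_mul NB (leqnn (2 * E * Z * d)).
  lia.
rewrite -CE.
apply: leq_trans (_ : 2 * E * (8 * Z) * (N ^ 3 * c) <= _).
  by apply: leq_mul; rewrite ?leq_mul2l ?n3 ?orbT // leq_mul2r N3 orbT.
have := leq_mul dH (leqnn (Z * c)); lia.
Qed.

Definition wrong (R : {set V}) (v w : V) : bool :=
  (rk v < rk w) && (g v w != model g rk K k R v w).

(** Sums the five error counts. By [kH], [KH] and [NH] respectively, [SB], [SC] and the group of the
    other three each cost at most a proportion 1/(16 E) of [N * N]. *)
Lemma sum_wrong_good (P : {set V}) : good g rk P -> #|P| = N ->
  2 * E * (\sum_(v in P) \sum_(w in P :\ v) wrong (P :\ v :\ w) v w) <= N * N.-1.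
Proof.
move=> gP cP.
pose bef v w := before g rk v w.
pose SA := \sum_(v in P) \sum_(w in P) (bef v w && few_below g rk K (P :\ v :\ w) w).
pose SB := \sum_(v in P) \sum_(w in P :\ v) (split_below g rk k (P :\ v :\ w) w).
pose SC := \sum_(v in P) \sum_(w in P) (bef v w && apart g rk K k (P :\ v :\ w) v w).
pose SN := \sum_(v in P) \sum_(w in P) (bef v w && none_before g rk (P :\ v :\ w) v w).
pose SD := \sum_(v in P) \sum_(w in P) (bef v w && strays g rk K k (P :\ v :\ w) v w).
have sumcard (b : V -> V -> bool) v : \sum_(w in P) b v w = #|[set w in P | b v w]|.
  by rewrite -big_mkcondr /= sum1dep_card.
have hSA : SA <= N * K.
  rewrite /SA exchange_big /= -cP -sum_nat_const; apply: leq_sum => w wP.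
  rewrite (sumcard (fun w v => bef v w && few_below g rk K (P :\ v :\ w) w)).
  exact: card_few_below.
have hSB : SB * k <= N * (N * s).
  rewrite /SB big_distrl /= -{1}cP -sum_nat_const; apply: leq_sum => v vP.
  rewrite -big_mkcondr /= sum1dep_card.
  have gPv : good g rk (P :\ v) by apply: good_sub gP; apply: subD1set.
  have cPv : #|P :\ v| <= N by rewrite -cP subset_leq_card // subD1set.
  apply: leq_trans (card_split_below gsym rk_inj k gPv (leq_ltn_trans cPv sH)) _.
  by rewrite leq_mul2r cPv orbT.
have hSC : SC * K <= N * (N * (2 * k).+1).
  rewrite /SC exchange_big big_distrl /= -{1}cP -sum_nat_const; apply: leq_sum => w wP.
  rewrite (sumcard (fun w v => bef v w && apart g rk K k (P :\ v :\ w) v w)) -cP.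
  exact: card_apart.
have hSN : SN <= N * 1.
  rewrite /SN -cP -sum_nat_const; apply: leq_sum => v vP.
  rewrite (sumcard (fun v w => bef v w && none_before g rk (P :\ v :\ w) v w)).
  exact: card_none_before.
have hSD : SD <= N * (2 * k + 2).
  rewrite /SD exchange_big /= -cP -sum_nat_const; apply: leq_sum => w wP.
  rewrite (sumcard (fun w v => bef v w && strays g rk K k (P :\ v :\ w) v w)).
  apply: card_strays => //; nia.
have tot : \sum_(v in P) \sum_(w in P :\ v) wrong (P :\ v :\ w) v w <= SA + SB + SC + SN + SD.
  rewrite /SA /SB /SC /SN /SD -!big_split /=; apply: leq_sum => v vP.
  have sub (F : V -> nat) : \sum_(w in P :\ v) F w <= \sum_(w in P) F w.
    by rewrite (big_setD1 v vP) leq_addl.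
  apply: leq_trans (_ : \sum_(w in P :\ v) (bef v w && few_below g rk K (P :\ v :\ w) w +
    split_below g rk k (P :\ v :\ w) w + (bef v w && apart g rk K k (P :\ v :\ w) v w) +
    (bef v w && none_before g rk (P :\ v :\ w) v w) + (bef v w && strays g rk K k (P :\ v :\ w) v w)) <= _).
    apply: leq_sum => w; rewrite in_setD1 => /andP[wv wP].
    rewrite /wrong; case: (boolP (rk v < rk w)) => //= vw; case: (boolP (_ != _)) => //= err.
    have wP' : w \in P :\ v by rewrite in_setD1 wv.
    have gvw : good g rk (v |: (w |: (P :\ v :\ w))) by rewrite setD1K // setD1K.
    have := model_error gsym rk_inj gvw _ _ vw err; rewrite !in_setD1 !eqxx andbF => /(_ isT isT).
    case/andP=> gvw' /or4P H; rewrite /bef /before eq_sym wv vw gvw' /=.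
    case: H => [->|/andP[_ ->]|->|/orP[]->]; rewrite ?addnS ?addn1 //; lia.
  by rewrite !big_split /= !leq_add // sub.
have k0 : 0 < k by apply: leq_trans kH; rewrite !muln_gt0 E0.
have K0 : 0 < K by apply: leq_trans KH; rewrite !muln_gt0 E0.
have bB : 16 * E * SB <= N * N.
  rewrite -(leq_pmul2r k0); have := leq_mul (leqnn (16 * E)) hSB; have := leq_mul (leqnn (N * N)) kH; lia.
have bC : 16 * E * SC <= N * N.
  rewrite -(leq_pmul2r K0); have := leq_mul (leqnn (16 * E)) hSC; have := leq_mul (leqnn (N * N)) KH; lia.
have bA : 16 * E * (SA + SN + SD) <= N * N.
  have := leq_mul (leqnn N) NH; have : SA + SN + SD <= N * (K + 2 * k + 3) by lia.
  move=> h; have := leq_mul (leqnn (16 * E)) h; lia.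
have : 16 * E * (\sum_(v in P) \sum_(w in P :\ v) wrong (P :\ v :\ w) v w) <= 3 * (N * N).
  apply: leq_trans (leq_mul (leqnn _) tot) _; lia.
rewrite /N /=; nia.
Qed.

(** By [sum_subsets_del2] the total error is a sum over [N]-sets. Good sets contribute a proportion
    1/(2E) of their pairs, and the others make up at most a proportion 1/(2E) of all [N]-sets; so
    some [R] has error at most n^2 / E. *)
Lemma exists_model : exists R : {set V}, #|R| = m /\
  E * #|[set p : V * V | [&& p.1 \notin R, p.2 \notin R & wrong R p.1 p.2]]| <= n ^ 2.
Proof.
pose err (R : {set V}) := \sum_(w | w \notin R) \sum_(v | v \notin w |: R) wrong R v w.
have errE (R : {set V}) : #|[set p : V * V | [&& p.1 \notin R, p.2 \notin R & wrong R p.1 p.2]]| <= err R.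
  rewrite -sum1_card /err (exchange_big_dep (fun v => v \notin R)) /=; last first.
    by move=> w v _; rewrite in_setU1 negb_or => /andP[].
  rewrite pair_big_dep /= big_mkcond [X in _ <= X]big_mkcond /=; apply: leq_sum => -[v w] _ /=.
  rewrite inE /= in_setU1 negb_or.
  case: (boolP (v \in R)) => //= vR; case: (boolP (w \in R)) => //= wR.
  case: (boolP (wrong R v w)) => // h; rewrite andbT.
  by rewrite (_ : v != w) //; apply: contraTneq h => ->; rewrite /wrong ltnn.
have tot : E * \sum_(R : {set V} | #|R| == m) err R <= 'C(n, m) * n ^ 2.
  have EN : \sum_(R : {set V} | #|R| == m) err R =
     \sum_(P : {set V} | #|P| == N) \sum_(v in P) \sum_(w in P :\ v) wrong (P :\ v :\ w) v w.
    by rewrite -(sum_subsets_del2 (fun R v w => (wrong R v w : nat))).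
  have CN : N * N.-1 * 'C(n, N) <= 'C(n, m) * n ^ 2.
    have := mul_bin_left n m; have := mul_bin_left n m.+1; rewrite -/N /=.
    set c1 := 'C(n, m.+1); set c2 := 'C(n, N); set c := 'C(n, m) => h1 h2.
    have : N * N.-1 * c2 = (n - m.+1) * ((n - m) * c) 
      by rewrite /N /= -h2; transitivity (m.+1 * (m.+2 * c2)); [lia|rewrite h1; lia].
    move=> ->; rewrite mulnA [c * _]mulnC leq_mul2r; apply/orP; right.
    by rewrite -mulnn leq_mul // leq_subr.
  apply: leq_trans CN; rewrite -(leq_pmul2l (isT : 0 < 2)) EN.
  set b := fun P : {set V} => \sum_(v in P) \sum_(w in P :\ v) (wrong (P :\ v :\ w) v w : nat).
  have bt (P : {set V}) : #|P| = N -> b P <= N * N.-1.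
    move=> cP; rewrite /b -{1}cP -sum_nat_const; apply: leq_sum => v vP.
    apply: leq_trans (_ : \sum_(w in P :\ v) 1 <= _); first by apply: leq_sum => w _; apply: leq_b1.
    by rewrite sum1_card; have := cardsD1 v P; rewrite vP cP add1n => -[<-].
  have : 2 * E * \sum_(P : {set V} | #|P| == N) b P <=
     \sum_(P : {set V} | #|P| == N) (N * N.-1 + 2 * E * (N * N.-1) * ~~ good g rk P).
    rewrite big_distrr /=; apply: leq_sum => P /eqP cP.
    case: (boolP (good g rk P)) => gP /=; first by rewrite muln0 addn0; apply: sum_wrong_good.
    by rewrite muln1; apply: leq_trans (leq_addl _ _); rewrite leq_mul2l bt ?orbT.
  move=> H; rewrite mulnA; apply: leq_trans H _.
  rewrite big_split /= sum_nat_const -big_distrr /= -big_mkcondr /= sum1dep_card.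
  rewrite card_subsets -/n; have := leq_mul (leqnn (N * N.-1)) card_not_good.
  by move: #|[set _ | _]| 'C(n, N) (N * N.-1) => x y z; lia.
have [/existsP[R /andP[/eqP cR ER]]|/existsPn none] :=
    boolP [exists R : {set V}, (#|R| == m) && (E * err R <= n ^ 2)].
  by exists R; split=> //; apply: leq_trans ER; rewrite leq_mul2l errE orbT.
have : \sum_(R : {set V} | #|R| == m) (n ^ 2).+1 <= E * \sum_(R : {set V} | #|R| == m) err R.
  rewrite big_distrr /=; apply: leq_sum => R cR; have := none R; rewrite cR /= -ltnNge //.
move=> /leq_trans/(_ tot); rewrite sum_nat_const card_subsets.
by rewrite leq_pmul2l ?ltnn // bin_gt0; apply: leq_trans Nn; rewrite /N; lia.
Qed.
End Removal.

(** * Graphs far from chordal *)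

Section EditDistance.
Variables (V : finType) (g h : rel V).

Lemma edit_dist_bin : edit_dist g h <= 'C(#|V|, 2).
Proof.
rewrite -(card_subsets V 2); apply: subset_leq_card; apply/subsetP => e.
by rewrite !inE => /existsP[u /existsP[v /and3P[uv /eqP-> _]]]; rewrite cards2 uv.
Qed.

Hypotheses (gsym : forall u v, g u v = g v u) (hsym : forall u v, h u v = h v u).

Lemma edit_dist_ranked (rk : V -> nat) : injective rk ->
  edit_dist g h <=
    #|[set p : V * V | (rk p.1 < rk p.2) && (g p.1 p.2 != h p.1 p.2)]|.
Proof.
move=> rk_inj; apply: leq_trans (leq_imset_card (fun p : V * V => [set p.1; p.2]) _).
apply: subset_leq_card; apply/subsetP => e.
rewrite inE => /existsP[u /existsP[v /and3P[uv /eqP-> err]]]; apply/imsetP.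
case: (ltngtP (rk u) (rk v)) => [lt|lt|/rk_inj E]; last by rewrite E eqxx in uv.
  by exists (u, v) => //; rewrite inE lt.
by exists (v, u); [rewrite inE lt /= gsym hsym|rewrite setUC].
Qed.
End EditDistance.

Lemma edit_dist_refl (V : finType) (g : rel V) : edit_dist g g = 0.
Proof.
apply: eq_card0 => e; apply/negbTE; rewrite inE; apply/existsP => -[u /existsP[v]].
by rewrite eqxx !andbF.
Qed.

Lemma hole_of_not_chordal (V : finType) (g : rel V) : ~ chordal g ->
  exists l, [/\ 4 <= l, l <= #|V| & 0 < num_induced_cycles g l].
Proof.
move=> nch; have [/existsP[l /andP[l4 /existsP[S cS]]]|/existsPn none] := boolP
  [exists l : 'I_#|V|.+1, (4 <= l) && [exists S : {set V}, induced_cycle g l S]].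
  by exists l; split=> //; [rewrite -ltnS|apply/card_gt0P; exists S; rewrite inE].
case: nch => l S l4; apply/negP => cS; have [c cinj _] := induced_cycle_size cS.
have lV : l < #|V|.+1.
  by rewrite ltnS -[l]card_ord; apply: leq_card cinj.
by case/negP: (none (Ordinal lV)); rewrite l4; apply/existsP; exists S.
Qed.

Section FarFromChordal.
Variables (V : finType) (g : rel V).
Hypotheses (gsym : forall u v, g u v = g v u) (girr : forall u, g u u = false).
Variables (e s k K m d t q : nat).
Let n := #|V|.
Let N := m.+2.
Hypotheses (e0 : 0 < e) (s0 : 0 < s) (m0 : 0 < m) (d0 : 0 < d).
Hypotheses (kH : 16 * (8 * e) * s <= k) (KH : 16 * (8 * e) * (2 * k).+1 <= K)
  (NH : 16 * (8 * e) * (K + 2 * k + 3) <= N) (sH : N < 2 ^ s)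
  (dH : 16 * (8 * e) * N ^ 3 <= d) (tH : 4 * (d * t).+1 <= 2 ^ t)
  (qE : q = 2 * (d * t).+1) (qN : 8 * e * N <= q).
Hypothesis far : forall h : rel V, simple_graph h -> chordal h -> n ^ 2 <= e * edit_dist g h.

(** The last factor pays for sampling in a set of size only n / (8 e), the others for the sampling
    itself. *)
Let M := 2 * q.+1 * q ^ q * (8 * e) ^ q.

(** For bounded [n] a single hole suffices, as [q ^ q] exceeds [n ^ l]. *)
Lemma far_small_many_holes : 0 < n -> n <= q ->
  exists l, [/\ 4 <= l, l <= q & n ^ l <= M * num_induced_cycles g l].
Proof.
move=> n0 nq; have nch : ~ chordal g.
  by move=> /(far (conj gsym girr)); rewrite edit_dist_refl muln0 leqn0 expn_eq0 andbT; rewrite eqn0Ngt n0.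
have [l [l4 ln num0]] := hole_of_not_chordal nch.
exists l; split=> //; first exact: leq_trans nq.
have q0 : 0 < q by apply: leq_trans nq.
have h1 : n ^ l <= q ^ q.
  by apply: (@leq_trans (q ^ l)); [case: (l) l4 => // l' _; rewrite leq_exp2r|rewrite leq_pexp2l // (leq_trans ln)].
apply: leq_trans h1 _; apply: (@leq_trans (M * 1)); last by rewrite leq_mul2l num0 orbT.
rewrite muln1 /M -[X in X <= _]mul1n -[X in X <= _]muln1 !leq_mul // ?muln_gt0 ?expn_gt0 ?muln_gt0 ?e0 //.
Qed.

Lemma far_large_many_holes : q < n ->
  exists l, [/\ 4 <= l, l <= q & n ^ l <= M * num_induced_cycles g l].
Proof.
move=> qn.
have [/existsP[l /andP[l4 lH]]|/existsPn none] := boolP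
  [exists l : 'I_q.+1, (4 <= l) && (n ^ l <= M * num_induced_cycles g l)].
  by exists l; split=> //; rewrite -ltnS.
exfalso.
have n0 : 0 < n by apply: leq_ltn_trans qn.
have near (U : {set V}) : n <= 8 * e * #|U| -> exists2 v, v \in U & d * #|open_pairs g U v| <= n ^ 2.
  move=> nU; have [/exists_inP //|/exists_inPn H] :=
    boolP [exists v in U, d * #|open_pairs g U v| <= n ^ 2].
  exfalso.
  have U0 : 0 < #|U| by case: #|U| nU => //; rewrite muln0 leqNgt n0.
  have many v : v \in U -> #|U| ^ 2 <= d * #|open_pairs g U v|.
    move=> /H; rewrite -ltnNge => /ltnW; apply: leq_trans.
    by rewrite leq_exp2r // max_card.
  have [l [l4 lq lH]] := many_holes_of_open_pairs gsym girr d0 erefl tH many U0.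
  rewrite -qE in lq lH; have lq1 : l < q.+1 by rewrite ltnS.
  have := none (Ordinal lq1); rewrite /= l4 /= => /negP[].
  have h1 : n ^ l <= (8 * e * #|U|) ^ l by case: (l) l4 => // l' _; rewrite leq_exp2r.
  apply: leq_trans h1 _; rewrite expnMn.
  have h2 : (8 * e) ^ l <= (8 * e) ^ q by rewrite leq_pexp2l // muln_gt0.
  apply: leq_trans (leq_mul h2 lH) _; rewrite /M; move: (num_induced_cycles g l) (_ ^ q) (_ ^ q) => x y z; lia.
have [rk [U0 [rk_inj0 U0n lat]]] := greedy_ordering near setT.
have rk_inj : injective rk by move=> u v; apply: rk_inj0; rewrite inE.
(* Isolating the leftover [U0] confines the bad cherries to vertices controlled by the greedy
   ordering. *)
pose g1 : rel V := fun u v => [&& g u v, u \notin U0 & v \notin U0].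
have g1sym u v : g1 u v = g1 v u by rewrite /g1 gsym; case: (u \in U0); rewrite /= ?andbF ?andbT.
have few : d * #|cherries g1 rk| <= n ^ 3.
  pose later a := [set p in open_pairs g setT a | (rk a < rk p.1) && (rk a < rk p.2)].
  apply: (@leq_trans (d * \sum_(a | a \notin U0) #|later a|)).
    rewrite leq_mul2l; apply/orP; right.
    pose f (t0 : V * V * V) := (t0.1.1, (t0.1.2, t0.2)).
    have finj : injective f by move=> [[a b] c] [[a' b'] c'] [-> -> ->].
    rewrite -(card_imset _ finj).
    apply: (@leq_trans #|\bigcup_(a | a \notin U0) [set (a, p) | p in later a]|).
      apply: subset_leq_card; apply/subsetP => _ /imsetP[[[a b] c] + ->]; rewrite inE /= => /and5P[/= ab bc].
      move=> /and3P[gab aU bU] /and3P[gac _ cU] nbc.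
      apply/bigcupP; exists a => //; apply/imsetP; exists (b, c) => //.
      rewrite !inE /= gab gac ab (ltn_trans ab bc) andbT /=.
      rewrite (_ : b != c) /=; last by apply: contraTneq bc => ->; rewrite ltnn.
      by move: nbc; rewrite /g1 bU cU !andbT.
    apply: leq_trans (card_bigcup_leq _ _) _; apply: leq_sum => a _; exact: leq_imset_card.
  rewrite big_distrr /=; apply: (@leq_trans (\sum_(a | a \notin U0) n ^ 2)).
    by apply: leq_sum => a aU; apply: lat; rewrite ?inE.
  by rewrite sum_nat_const expnS leq_mul2r max_card orbT.
have E0 : 0 < 8 * e by rewrite muln_gt0.
have Nn : 8 * e * N <= n by apply: leq_trans qN (ltnW qn).
have NN : N <= n by apply: leq_trans Nn; rewrite leq_pmull.
have n4 : 3 < n by apply: leq_ltn_trans qn; apply: leq_trans qN; rewrite /N; clear -e0; nia.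
have [R [cR wR]] := exists_model g1sym rk_inj E0 s0 n4 NN m0 kH KH NH sH dH few.
pose h := model g1 rk K k R.
have hs : simple_graph h := model_simple g1 rk K k R.
have hc : chordal h := model_chordal g1sym rk_inj K k R.
have [hsym _] := hs.
pose W := [set p : V * V | [&& p.1 \notin R, p.2 \notin R & wrong g1 rk k K R p.1 p.2]].
(* Edits meet [U0], meet [R], or are wrong pairs: with weights 2, 2 and 1, at most 5 n^2 / (8 e) in
   all, below the assumed distance n^2 / e. *)
have ed : edit_dist g h <= 2 * (n * #|U0|) + 2 * (n * m) + #|W|.
  apply: leq_trans (edit_dist_ranked gsym hsym rk_inj) _.
  apply: (@leq_trans #|(setX U0 setT :|: setX setT U0) :|: (setX R setT :|: setX setT R) :|: W|).
    apply: subset_leq_card; apply/subsetP => -[u v]; rewrite inE /= => /andP[uv err].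
    rewrite !in_setU !in_setX !in_setT !andbT inE /= /wrong uv /= /g1.
    case: (u \in U0) => //=; case: (v \in U0) => //=; case: (u \in R) => //=; case: (v \in R) => //=.
    by rewrite !andbT.
  have cU (A B : {set V * V}) : #|A :|: B| <= #|A| + #|B| by case: (leq_card_setU A B).
  apply: leq_trans (cU _ _) _; rewrite leq_add2r; apply: leq_trans (cU _ _) _.
  by apply: leq_add; apply: leq_trans (cU _ _) _; rewrite !cardsX cardsT ?cR -/n; lia.
have := far hs hc; rewrite leqNgt => /negP[].
have h1 : n * (8 * e * #|U0|) <= n * n by rewrite leq_mul2l ltnW ?orbT.
have h2 : n * (8 * e * m) <= n * n.
  rewrite leq_mul2l; apply/orP; right; apply: leq_trans Nn; rewrite leq_mul2l; apply/orP; right.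
  by rewrite /N -addn2 leq_addr.
have h3 : 8 * e * #|W| <= n * n by rewrite mulnn.
have h4 := leq_mul (leqnn (8 * e)) ed.
have n2 : 0 < n * n by rewrite muln_gt0 n0.
rewrite -mulnn; move: h1 h2 h3 h4 n2; move: (edit_dist g h) #|U0| #|W| => x y z; clear; nia.
Qed.

Lemma far_many_holes : 0 < n -> exists l, [/\ 4 <= l, l <= q & n ^ l <= M * num_induced_cycles g l].
Proof. by case: (leqP n q) => [nq /far_small_many_holes|/far_large_many_holes //]; apply. Qed.
End FarFromChordal.

(** * Choice of the constants *)

Section Constants.
(* A variable, so that [b ^ 97] is never evaluated. *)
Variable b : nat.
Hypothesis bE : b = 2.

(** This is the sample size [q = 2 * (d * t).+1], with [d] and [t] as chosen in
    [far_from_chordal_holes]. *)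
Definition hole_bound (e : nat) : nat := 2 * (b ^ 97 * e ^ 13 * (b ^ 8 * e)).+1.

Let b0 j : 0 < b ^ j. Proof. by rewrite expn_gt0 bE. Qed.
Let b2 : b ^ 2 = 4. Proof. by rewrite bE. Qed.

Lemma leq_monomial i i' j j' e : 0 < e -> i <= i' -> j <= j' ->
  b ^ i * e ^ j <= b ^ i' * e ^ j'.
Proof. by move=> e0 ii jj; rewrite leq_mul // leq_pexp2l // bE. Qed.

Lemma mul_monomial i i' j j' e :
  b ^ i * e ^ j * (b ^ i' * e ^ j') = b ^ (i + i') * e ^ (j + j').
Proof. by rewrite mulnACA -!expnD. Qed.

Lemma monomial_leq_exp i j c e : 0 < e -> i + j * e <= c -> b ^ i * e ^ j <= b ^ c.
Proof.
move=> e0 ijc; apply: leq_trans (_ : b ^ (i + j * e) <= _); last by rewrite leq_pexp2l // bE.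
rewrite expnD leq_mul2l mulnC expnM; apply/orP; right.
by case: j {ijc} => // j; rewrite leq_exp2r // ltnW // ltn_expl // bE.
Qed.

Lemma hole_boundE e : hole_bound e = 2 * (b ^ 105 * e ^ 14).+1.
Proof. by rewrite /hole_bound -{2}[e]expn1 mul_monomial. Qed.

Lemma hole_bound_leq e : 0 < e -> hole_bound e <= b ^ 107 * e ^ 14.
Proof.
move=> e0; rewrite hole_boundE.
have -> : b ^ 107 = 4 * b ^ 105 by rewrite -b2 -expnD.
have : 0 < e ^ 14 by rewrite expn_gt0 e0.
by move: (b0 105); move: (b ^ 105) (e ^ 14); clear; nia.
Qed.

Lemma far_from_chordal_holes (V : finType) (g : rel V) (e : nat) :
    0 < e -> 0 < #|V| -> simple_graph g ->
    (forall h : rel V, simple_graph h -> chordal h -> #|V| ^ 2 <= e * edit_dist g h) ->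
  exists l, [/\ 4 <= l, l <= hole_bound e &
    #|V| ^ l <= b ^ (4 * hole_bound e ^ 2) * num_induced_cycles g l].
Proof.
move=> e0 V0 [gsym girr] far.
(* Each parameter is a monomial in [b = 2] and [e], chosen in turn so that the constraints reduce to
   comparing exponents. Only [s] and [t] must beat logarithms, for which linear growth in [e]
   suffices. *)
pose s := b ^ 6 * e ^ 1; pose k := b ^ 13 * e ^ 2; pose K := b ^ 22 * e ^ 3.
pose N := b ^ 30 * e ^ 4; pose d := b ^ 97 * e ^ 13; pose t := b ^ 8 * e ^ 1.
set q := hole_bound e; pose m := N - 2.
have pe j : 0 < e ^ j by rewrite expn_gt0 e0.
have E : 16 * (8 * e) = b ^ 7 * e ^ 1 by rewrite mulnA bE.
have N4 : 4 <= N.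
  by rewrite -b2 -[X in X <= _]muln1 -[X in _ * X <= _](expn0 e) leq_monomial.
have mN : m.+2 = N by rewrite /m -addn2 subnK // (leq_trans _ N4).
have kH : 16 * (8 * e) * s <= k by rewrite E mul_monomial.
have k0 : 0 < k by rewrite muln_gt0 b0 pe.
have kK : 4 * k <= K.
  by rewrite -b2 -[b ^ 2]muln1 -(expn0 e) mul_monomial leq_monomial.
have KH : 16 * (8 * e) * (2 * k).+1 <= K.
  rewrite E; apply: leq_trans (_ : b ^ 7 * e ^ 1 * (b ^ 2 * e ^ 0 * k) <= _).
    by rewrite leq_mul2l b2; apply/orP; right; rewrite expn0; move: k0; clear; lia.
  by rewrite !mul_monomial leq_monomial.
have NH : 16 * (8 * e) * (K + 2 * k + 3) <= m.+2.
  rewrite mN E; apply: leq_trans (_ : b ^ 7 * e ^ 1 * (b ^ 1 * e ^ 0 * K) <= _).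
    rewrite leq_mul2l [b ^ 1]expn1 {2}bE; apply/orP; right; rewrite expn0.
    have : 4 <= k by rewrite -b2 -[b ^ 2]muln1 -(expn0 e) leq_monomial.
    by move: kK; clear; lia.
  by rewrite !mul_monomial leq_monomial.
have sH : m.+2 < 2 ^ s.
  have -> : 2 ^ s = b ^ s by rewrite bE.
  rewrite mN; apply: leq_trans (_ : b ^ 31 * e ^ 4 <= _).
    have -> : b ^ 31 = 2 * b ^ 30 by rewrite expnS {1}bE.
    by rewrite -mulnA mul2n -addnn -addn1 leq_add2l (leq_trans _ N4).
  apply: monomial_leq_exp => //; rewrite /s (_ : b ^ 6 = 64); last by rewrite bE.
  by rewrite expn1; move: e0; clear; lia.
have dH : 16 * (8 * e) * m.+2 ^ 3 <= d.
  by rewrite mN E /N expnMn -!expnM mul_monomial leq_monomial.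
have d0 : 0 < d by rewrite muln_gt0 b0 pe.
have t0 : 0 < t by rewrite muln_gt0 b0 pe.
have tH : 4 * (d * t).+1 <= 2 ^ t.
  have -> : 2 ^ t = b ^ t by rewrite bE.
  apply: leq_trans (_ : b ^ 2 * e ^ 0 * (b ^ 2 * e ^ 0 * (d * t)) <= _).
    have : 0 < d * t by rewrite muln_gt0 d0 t0.
    by rewrite b2 expn0; move: (d * t); clear; lia.
  rewrite !mul_monomial.
  apply: monomial_leq_exp => //; rewrite /t (_ : b ^ 8 = 256); last by rewrite bE.
  by rewrite expn1; move: e0; clear; lia.
have qN : 8 * e * m.+2 <= q.
  have -> : 8 * e = b ^ 3 * e ^ 1 by rewrite bE.
  rewrite mN mul_monomial /q hole_boundE.
  apply: leq_trans (_ : b ^ 105 * e ^ 14 <= _); first exact: leq_monomial.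
  by move: (b ^ 105 * e ^ 14); clear; lia.
have s0 : 0 < s by rewrite muln_gt0 b0 pe.
have m0 : 0 < m by rewrite subn_gt0 (leq_trans _ N4).
have [l [l4 lq H]] := far_many_holes gsym girr e0 s0 m0 d0 kH KH NH sH dH tH erefl qN far V0.
exists l; split=> //; apply: leq_trans H _; rewrite leq_mul2r; apply/orP; right.
rewrite -[X in 2 * X.+1]/q -/q.
have e8 : 8 * e <= q by apply: leq_trans qN; rewrite leq_pmulr.
have q8 : 8 <= q by apply: leq_trans e8; rewrite leq_pmulr.
have qb : q <= b ^ q by rewrite ltnW // ltn_expl // bE.
have qq : q ^ q <= b ^ (q * q) by rewrite expnM leq_exp2r // (leq_trans _ q8).
have eq : (8 * e) ^ q <= b ^ (q * q).
  by apply: leq_trans qq; rewrite leq_exp2r // (leq_trans _ q8).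
have q1 : 2 * q.+1 <= b ^ q.+2.
  by rewrite expnS {1}bE leq_mul2l /= ltnW // ltn_expl // bE.
apply: leq_trans (leq_mul (leq_mul q1 qq) eq) _; rewrite -!expnD leq_pexp2l // ?bE // -mulnn.
by move: q8; move: (q); clear; nia.
Qed.
End Constants.

(* Passage to real numbers *)
From Stdlib Require Import Reals Lra.

Lemma INR_muln (a j : nat) : INR (muln a j) = (INR a * INR j)%R.
Proof. exact: mult_INR. Qed.

Lemma INR_expn (a j : nat) : INR (expn a j) = (INR a ^ j)%R.
Proof. by elim: j => [|j IH]; rewrite ?expn0 // expnS INR_muln IH. Qed.

Lemma INR_leq (a j : nat) : leq a j -> (INR a <= INR j)%R.
Proof. by move/leP; apply: le_INR. Qed.

Lemma nat_ceiling (x : R) : (1 <= x)%R -> exists e : nat, (x <= INR e <= 2 * x)%R.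
Proof.
move=> x1; have [h1 h2] := archimed x.
have up0 : (0 <= up x)%Z by apply: le_IZR; lra.
by have [e eE] := IZN _ up0; exists e; rewrite INR_IZR_INZ -eE; lra.
Qed.

(** Deleting all edges takes at most n^2 / 2 edits. The resulting bound 1/eps >= 2 lets powers of 2
    be absorbed into powers of 1/eps. *)
Lemma far_eps_half (V : finType) (g : rel V) (eps : R) :
  eps_far_from_chordal g eps -> leq 1 #|V| -> (eps <= / 2)%R.
Proof.
move=> far V0; pose h : rel V := fun _ _ => false.
have hc : chordal h.
  apply: chordal_of_simplicial => Q /set0Pn[v vQ]; exists v => //.
  by apply/simplicial_inP.
have n0 : (0 < INR #|V|)%R by apply: lt_0_INR; apply/ltP.
have dle : (INR (edit_dist g h) * 2 <= INR #|V| ^ 2)%R.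
  rewrite -(_ : INR 2 = 2%R) // -INR_muln -INR_expn; apply: INR_leq.
  have := edit_dist_bin g h; have := mul_bin_left #|V| 1; rewrite bin1.
  by move: (edit_dist _ _) #|V| 'C(_, _) => a n c; clear; nia.
have := far h (conj (fun _ _ => erefl) (fun=> erefl)) hc.
have : (0 < INR #|V| ^ 2)%R by apply: pow_lt.
nra.
Qed.

Theorem theorem1p2 :
  exists c C : R, (0 < c)%R /\ (0 < C)%R /\
    forall (V : finType) (g : rel V) (eps : R),
      (0 < eps < 1)%R ->
      simple_graph g ->
      eps_far_from_chordal g eps ->
      exists l : nat,
        (4 <= l)%N /\ (INR l <= C * (/ eps) ^ 18)%R /\
        (INR #|V| ^ l / Rpower 2 (Rpower (/ eps) c) <= INR (num_induced_cycles g l))%R.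
Proof.
have [b bE] : exists b : nat, b = 2 by exists 2.
have B2 : INR b = 2%R by rewrite bE.
(* With x = 1/eps and e <= 2x, [q] is at most 2^107 * 2^14 * x^14 <= x^135, so 4 q^2 <= x^272. The
   factor 4 in [C] serves the empty graph, where [l = 4]. *)
exists (INR 272), (4 * (INR b ^ 107 * 2 ^ 14))%R.
have B107 : (1 <= INR b ^ 107)%R by apply: pow_R1_Rle; lra.
have two14 : (1 <= 2 ^ 14)%R by apply: pow_R1_Rle; lra.
have C1 : (1 <= INR b ^ 107 * 2 ^ 14)%R by nra.
split; first by apply: lt_0_INR; apply/ltP.
split; first by lra.
move=> V g eps [eps0 eps1] gs far.
have x1 : (1 < / eps)%R by rewrite -Rinv_1; apply: Rinv_lt_contravar; lra.
set x := (/ eps)%R in x1 *.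
have pos2 : (0 < Rpower 2 (Rpower x (INR 272)))%R by apply: exp_pos.
have x18 : (1 <= x ^ 18)%R by apply: pow_R1_Rle; lra.
have [V0|V0] := posnP #|V|.
  exists 4; rewrite V0; split=> //; split; first by rewrite (_ : INR 4 = 4%R); [nra|rewrite /=; lra].
  rewrite (_ : (INR 0 ^ 4 / _ = 0)%R); first exact: pos_INR.
  by rewrite /Rdiv /= !Rmult_0_l.
have epsh := far_eps_half far V0.
have x2 : (2 <= x)%R by rewrite -[2%R]Rinv_inv; apply: Rinv_le_contravar; lra.
have [e [xe ex]] := nat_ceiling (Rlt_le _ _ x1).
have e0 : leq 1 e by apply/ltP; apply: INR_lt; rewrite /=; lra.
have nfar (h : rel V) : simple_graph h -> chordal h -> leq (expn #|V| 2) (muln e (edit_dist g h)).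
  move=> hs hc; apply/leP; apply: INR_le; rewrite INR_expn INR_muln.
  have := far h hs hc; set D := INR (edit_dist g h) => H.
  have D0 : (0 <= D)%R by apply: pos_INR.
  apply: (Rle_trans _ (x * D)); last by apply: Rmult_le_compat_r.
  have <- : (x * (eps * INR #|V| ^ 2) = INR #|V| ^ 2)%R by rewrite /x; field; lra.
  by apply: Rmult_le_compat_l => //; lra.
have [l [l4 lq H]] := far_from_chordal_holes bE e0 V0 gs nfar.
have qb := hole_bound_leq bE e0.
set q := hole_bound b e in lq H qb.
have e_le j : (INR e ^ j <= 2 ^ j * x ^ j)%R.
  by rewrite -Rpow_mult_distr; apply: pow_incr; split; [apply: pos_INR|].
have qR : (INR q <= INR b ^ 107 * (INR e ^ 14))%R.
  by rewrite -!INR_expn -INR_muln; apply: INR_leq.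
exists l; split=> //; split.
  apply: (Rle_trans _ (INR q)); first exact: INR_leq.
  apply: (Rle_trans _ _ _ qR).
  have h14 := e_le 14.
  have x14 : (x ^ 14 <= x ^ 18)%R by apply: Rle_pow; [lra|apply/leP].
  apply: (Rle_trans _ (INR b ^ 107 * (2 ^ 14 * x ^ 18))%R).
    apply: Rmult_le_compat_l; first by lra.
    apply: (Rle_trans _ _ _ h14); apply: Rmult_le_compat_l => //; lra.
  rewrite -Rmult_assoc; apply: Rmult_le_compat_r; lra.
have exponent : (INR (muln 4 (expn q 2)) <= x ^ 272)%R.
  rewrite INR_muln INR_expn.
  apply: (Rle_trans _ (x ^ 2 * (x ^ 107 * (x ^ 14 * x ^ 14)) ^ 2)%R); last first.
    rewrite -!pow_add -pow_mult -pow_add; apply: Req_le; congr (_ ^ _)%R.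
  have x0 : (0 <= x)%R by lra.
  apply: Rmult_le_compat; [exact: pos_INR|by apply: pow_le; apply: pos_INR| |].
    by rewrite (_ : INR 4 = 2 ^ 2)%R; [apply: pow_incr; lra|rewrite /=; lra].
  apply: pow_incr; split; first exact: pos_INR.
  apply: (Rle_trans _ _ _ qR).
  apply: Rmult_le_compat; [by apply: pow_le; apply: pos_INR|by apply: pow_le; apply: pos_INR| |].
    by apply: pow_incr; lra.
  apply: (Rle_trans _ _ _ (e_le 14)).
  by apply: Rmult_le_compat_r; [apply: pow_le|apply: pow_incr; lra].
apply: (Rmult_le_reg_r _ _ _ pos2).
rewrite /Rdiv Rmult_assoc Rinv_l ?Rmult_1_r; last by apply: Rgt_not_eq.
rewrite -INR_expn; apply: (Rle_trans _ _ _ (INR_leq H)).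
rewrite INR_muln Rmult_comm; apply: Rmult_le_compat_l; first exact: pos_INR.
rewrite INR_expn B2 -Rpower_pow; last by lra.
apply: Rle_Rpower; first by lra.
by rewrite Rpower_pow; [exact: exponent|lra].
Qed.
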